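(* Let $K$ be a field, $f:\mathbb Z_{\ge0}\to\mathbb R_{\ge0}$ an increasing function with $\sum_{\alpha\ge0}f(2^\alpha)/2^\alpha<+\infty$, and $B=\bigoplus_{n\ge0}B_n$ an integral graded $K$-algebra of finite type, generated by $B_1$. Suppose (i) the Krull dimension of $B$ is $>0$; (ii) each $B_n$ ($n\ge1$) carries a separated, exhaustive, left continuous $\mathbb R$-filtration making $B$ an $f$-pseudo-filtered graded $K$-algebra; (iii) $\limsup_{n\to\infty}\sup_{0\ne a\in B_n}\lambda(a)/n<+\infty$. Let $\nu_n=T_{1/n}\nu_{B_n}$. Then the supports of the $\nu_n$ ($n\ge1$) lie in a common bounded interval and $(\nu_n)_{n\ge1}$ converges vaguely to a Borel probability measure on $\mathbb R$.
   Context: Filtrations: decreasing families $(B_{n,s})_{s\in\mathbb R}$ of subspaces; separated: $\bigcap_sB_{n,s}=0$; exhaustive: $\bigcup_sB_{n,s}=B_n$; left continuous: $B_{n,s}=\bigcap_{t<s}B_{n,t}$; index $\lambda(a)=\sup\{s:a\in B_{n,s}\}$. $B$ is $f$-pseudo-filtered if $B_{n,s}B_{m,t}\subseteq B_{n+m,\,s+t-f(n)-f(m)}$ for all sufficiently large integers $n,m$ and all $s,t\in\mathbb R$. For nonzero finite-dimensional $W$, $\nu_W$ is the Borel probability measure with $\nu_W([r,+\infty[)=\dim\mathcal F_rW/\dim W$. $T_\varepsilon\nu$: image of $\nu$ under $x\mapsto\varepsilon x$. Vague convergence: convergence of integrals of continuous compactly supported functions. *)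

(* Defs.v *)
From HB Require Import structures.
From mathcomp Require Import all_boot all_order all_algebra.
From mathcomp Require Import all_classical all_reals all_analysis.
From mathcomp Require Import measurable_realfun.
Set Implicit Arguments. Unset Strict Implicit. Unset Printing Implicit Defensive.
Import Order.TTheory GRing.Theory Num.Theory.
Import numFieldNormedType.Exports.
Local Open Scope ring_scope.
Local Open Scope classical_set_scope.

Section LinAlg.
Context (K : fieldType) (A : lmodType K).

Definition is_subspace (W : A -> Prop) : Prop :=
  W 0 /\ forall (c : K) (u v : A), W u -> W v -> W (c *: u + v).

Definition lin_free (s : seq A) : Prop :=
  forall c : 'I_(size s) -> K,
    \sum_(i < size s) c i *: s`_i = 0 -> forall i, c i = 0.

Definition has_dim (W : A -> Prop) (d : nat) : Prop :=
  (exists s : seq A, size s = d /\ (forall x, x \in s -> W x) /\ lin_free s) /\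
  (forall s : seq A, (forall x, x \in s -> W x) -> lin_free s -> (size s <= d)%N).

End LinAlg.

Section Alg.
Context (K : fieldType) (A : comAlgType K).

Definition in_alg_gen (P : A -> Prop) (a : A) : Prop :=
  exists (k : nat) (c : 'I_k -> K) (t : 'I_k -> seq A),
    (forall i x, x \in t i -> P x) /\
    a = \sum_(i < k) c i *: \prod_(x <- t i) x.

Definition finite_type_alg : Prop :=
  exists s : seq A, forall a : A, in_alg_gen (fun x => x \in s) a.

Definition integral_alg : Prop :=
  (1 : A) != 0 /\ forall a b : A, a * b = 0 -> a = 0 \/ b = 0.

Definition prime_ideal (P : A -> Prop) : Prop :=
  [/\ P 0, (forall a b, P a -> P b -> P (a - b)),
      (forall r a, P a -> P (r * a)), ~ P 1 &
      (forall a b, P (a * b) -> P a \/ P b)].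

Definition krull_dim_pos : Prop :=
  exists P Q : A -> Prop, prime_ideal P /\ prime_ideal Q /\
    (forall x, P x -> Q x) /\ (exists x, Q x /\ ~ P x).

Definition graded_alg (B : nat -> A -> Prop) : Prop :=
  [/\ (forall n, is_subspace (B n)),
      B 0 1,
      (forall n m a b, B n a -> B m b -> B (n + m)%N (a * b)),
      (forall a : A, exists (N : nat) (c : 'I_N -> A),
          (forall i : 'I_N, B i (c i)) /\ a = \sum_(i < N) c i) &
      (forall (N : nat) (c : 'I_N -> A),
          (forall i : 'I_N, B i (c i)) -> \sum_(i < N) c i = 0 ->
          forall i, c i = 0)].

Definition generated_by (P : A -> Prop) : Prop :=
  forall a : A, in_alg_gen P a.

End Alg.

Section Filt.
Context (R : realType) (K : fieldType) (A : lmodType K).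

Definition good_filtration (W : A -> Prop) (F : R -> A -> Prop) : Prop :=
  [/\ (forall s, is_subspace (F s) /\ forall a, F s a -> W a),
      (forall s t a, s <= t -> F t a -> F s a),
      (forall a, (forall s, F s a) -> a = 0),
      (forall a, W a -> exists s, F s a) &
      (forall s a, (forall t, t < s -> F t a) -> F s a)].

Definition flambda (F : R -> A -> Prop) (a : A) : \bar R :=
  ereal_sup [set s%:E | s in [set s | F s a]].

End Filt.

Section Meas.
Context (R : realType).
Local Open Scope ereal_scope.

Definition is_filtration_measure (K : fieldType) (A : lmodType K)
  (W : A -> Prop) (F : R -> A -> Prop) (nu : {measure set R -> \bar R}) : Prop :=
  forall (r : R) (d dr : nat), has_dim W d -> has_dim (F r) dr ->
    nu `[r, +oo[ = (dr%:R / d%:R)%:E.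

Section Tscale.
Context (eps : R) (nu : {measure set R -> \bar R}).
Definition Tscale := pushforward nu (fun x : R => (x * eps)%R).

Let mf : measurable_fun [set: R] (fun x : R => (x * eps)%R).
Proof. exact: mulrr_measurable. Qed.

Let Tscale0 : Tscale set0 = 0.
Proof. by rewrite /Tscale /pushforward preimage_set0 measure0. Qed.

Let Tscale_ge0 B : 0 <= Tscale B.
Proof. exact: measure_ge0. Qed.

Let Tscale_sigma_additive : semi_sigma_additive Tscale.
Proof.
move=> F mF tF mUF; rewrite /Tscale /pushforward preimage_bigcup.
apply: measure_semi_sigma_additive.
- by move=> n; rewrite -[X in measurable X]setTI; exact: mf.
- apply/trivIsetP => /= i j _ _ ij; rewrite -preimage_setI.
  by move/trivIsetP : tF => /(_ _ _ _ _ ij) ->//; rewrite preimage_set0.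
- by rewrite -preimage_bigcup -[X in measurable X]setTI; exact: mf.
Qed.

HB.instance Definition _ := isMeasure.Build _ _ _
  Tscale Tscale0 Tscale_ge0 Tscale_sigma_additive.
End Tscale.

Definition msupport (nu : {measure set R -> \bar R}) : set R :=
  [set x : R | forall U : set R, open U -> U x -> 0 < nu U].

Definition vague_cvg (nus : nat -> {measure set R -> \bar R})
    (nu : {measure set R -> \bar R}) : Prop :=
  forall phi : R -> R, continuous phi ->
    compact (closure [set x | phi x != 0%R]) ->
    (fun n => \int[nus n]_x (phi x)%:E) @ \oo --> \int[nu]_x (phi x)%:E.

End Meas.

(* Main.v *)
(** The theorem follows from the inequality
      [dim (E^k B_(dk)) >= k^d dim E]
    for finite dimensional subspaces [E] of the domain [B], where [d] is such that
    [dim B_n = O(n^d)]. To prove it, dehomogenize by a nonzero [x_0] in [B_1], choose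
    algebraically independent quotients [x_i / x_0] with [x_i] in [B_1], and for each
    of them pass from [E] to the polynomials in [T] with coefficients in [E], filtered
    by the order of vanishing at the generic point [T = x_i / x_0]. The graded pieces
    (leaves) are modules over a polynomial ring with one more variable, their ranks
    add up to [dim E], and leading coefficients multiply without cancellation because
    [B] is a domain. Hence the leaf of order [k j + u] ([u < k]) of [E^k B_(dk)]
    contains the [k]-th power of the leaf of order [j] of [E].

    Applied to [E = F_p (p t)], with errors controlled by products formed by dyadic
    halving and by the summability of [f(2^a) / 2^a], the inequality yields
      [limsup_p dim F_p (p t) / p^d <= liminf_n dim F_n (n (t - e)) / n^d]
    for all [e > 0]. So the distribution functions of the measures converge at the
    continuity points of a monotone function, which is that of the limit. *)

Require Import Defs.
From HB Require Import structures.
From mathcomp Require Import all_boot all_order all_algebra.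
From mathcomp Require Import all_classical all_reals all_analysis.
From mathcomp Require Import measurable_realfun.
From mathcomp Require Import zify ring lra.
Set Implicit Arguments. Unset Strict Implicit. Unset Printing Implicit Defensive.
Import Order.TTheory GRing.Theory Num.Theory.
Import numFieldNormedType.Exports.
Local Open Scope ring_scope.
Local Open Scope classical_set_scope.

Lemma map_preimage (T T' : eqType) (g : T -> T') (P : T -> Prop) (s : seq T') :
  (forall y, y \in s -> exists2 x, P x & g x = y) ->
  exists2 t, map g t = s & forall x, x \in t -> P x.
Proof.
elim: s => [|y s IH] hs; first by exists [::].
have [t <- Pt] := IH (fun z zs => hs z (mem_behead (s := y :: s) zs)).
have [x Px <-] := hs y (mem_head _ _).
by exists (x :: t) => // z; rewrite inE => /predU1P[->|/Pt].
Qed.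

Lemma exists_argmin (T : Type) (g : T -> nat) (t0 : T) :
  exists t, forall u, (g t <= g u)%N.
Proof.
have ex : exists m, `[< exists t, g t = m >] by exists (g t0); apply/asboolP; exists t0.
case: (ex_minnP ex) => _ /asboolP[t <-] gmin; exists t => u.
by apply: gmin; apply/asboolP; exists u.
Qed.

Lemma exists_argmax (T : Type) (g : T -> nat) (t0 : T) M :
  (forall t, (g t <= M)%N) -> exists t, forall u, (g u <= g t)%N.
Proof.
move=> gM; have [t ht] := exists_argmin (fun u => M - g u)%N t0.
by exists t => u; move: (ht u) (gM u) (gM t); lia.
Qed.

Section PowColon.
Context (A : nzRingType).
Implicit Types (V W X : A -> Prop).

(* The colon [(W : V ^ N)]. *)
Definition pow_colon (N : nat) V W (a : A) : Prop := forall es : seq A,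
  size es = N -> (forall e, e \in es -> V e) -> W ((\prod_(e <- es) e) * a).

Definition pow_mul_sub (N : nat) V X W : Prop := forall a, X a -> pow_colon N V W a.

Lemma pow_colonS N V W v a :
  V v -> pow_colon N.+1 V W a -> pow_colon N V (fun b => W (v * b)) a.
Proof.
move=> Vv h es ses Ves; have := h (v :: es); rewrite /= ses big_cons mulrA; apply=> //.
by move=> e; rewrite inE => /predU1P[->|/Ves].
Qed.

End PowColon.

(** * Linear independence over a ring *)

(* Through [iota] the ring [R] is a [k]-module; the morphism is kept explicit
   because [R] will carry several module structures at once. *)
Section Span.
Context (k R : nzRingType) (iota : {rmorphism k -> R}).
Implicit Types (s t : seq R) (W : R -> Prop).

Fixpoint in_span s (y : R) : Prop :=
  if s is x :: s' then exists c, in_span s' (y - iota c * x) else y = 0.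

Fixpoint indep s : Prop :=
  if s is x :: s' then (forall c, in_span s' (iota c * x) -> c = 0) /\ indep s'
  else True.

Definition submod W : Prop :=
  [/\ W 0, (forall a b, W a -> W b -> W (a + b)) &
      (forall c a, W a -> W (iota c * a))].

Definition has_indep W (m : nat) : Prop :=
  exists s, [/\ size s = m, (forall x, x \in s -> W x) & indep s].

Lemma in_span_submod s : submod (in_span s).
Proof.
elim: s => [|x s [s0 sD sZ]] /=.
  by split=> [//|a b -> ->|c a ->]; rewrite ?addr0 ?mulr0.
split.
- by exists 0; rewrite rmorph0 mul0r subr0.
- move=> a b [c ca] [c' cb]; exists (c + c').
  by rewrite rmorphD mulrDl opprD addrACA; exact: sD.
- move=> c a [c' ca]; exists (c * c').
  by rewrite rmorphM -mulrA -mulrBr; exact: sZ.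
Qed.

Lemma submodN W a : submod W -> W a -> W (- a).
Proof. by case=> _ _ WZ Wa; rewrite -mulN1r -(rmorph1 iota) -rmorphN; exact: WZ. Qed.

Lemma submodB W a b : submod W -> W a -> W b -> W (a - b).
Proof. by move=> sW Wa Wb; case: (sW) => _ WD _; apply: WD (submodN sW Wb). Qed.

Lemma submod_sum W (I : Type) (r : seq I) (P : pred I) (F : I -> R) :
  submod W -> (forall i, P i -> W (F i)) -> W (\sum_(i <- r | P i) F i).
Proof. by case=> W0 WD _ WF; apply: big_ind. Qed.

Lemma in_span_min W s y :
  submod W -> (forall x, x \in s -> W x) -> in_span s y -> W y.
Proof.
move=> sW; case: (sW) => W0 WD WZ; elim: s y => [|x s IH] y Ws /=; first by move->.
case=> c /IH h; rewrite -[y](subrK (iota c * x)); apply: WD.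
  by apply: h => z zs; apply: Ws; rewrite inE zs orbT.
by apply: WZ; apply: Ws; rewrite mem_head.
Qed.

Lemma in_span_cons s x y : in_span s y -> in_span (x :: s) y.
Proof. by exists 0; rewrite rmorph0 mul0r subr0. Qed.

Lemma mem_in_span s x : x \in s -> in_span s x.
Proof.
elim: s => [//|z s IH]; rewrite inE => /predU1P[->|/IH]; last exact: in_span_cons.
by exists 1; rewrite rmorph1 mul1r subrr; case: (in_span_submod s).
Qed.

Lemma in_spanS s t y : {subset s <= t} -> in_span s y -> in_span t y.
Proof.
move=> st; apply: in_span_min; first exact: in_span_submod.
by move=> x /st; exact: mem_in_span.
Qed.

Lemma in_span_mulr s y a : in_span s y -> in_span [seq x * a | x <- s] (y * a).
Proof.
elim: s y => [|x s IH] y /=; first by move->; rewrite mul0r.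
by case=> c /IH; rewrite mulrBl -mulrA; exists c.
Qed.

Lemma in_spanP s y :
  in_span s y <-> exists c : nat -> k, y = \sum_(i < size s) iota (c i) * s`_i.
Proof.
elim: s y => [|x s IH] y /=.
  by split=> [->|[c ->]]; [exists (fun=> 0)|]; rewrite big_ord0.
split=> [[a /IH[c E]]|[c ->]].
  exists (fun i => if i is j.+1 then c j else a).
  by rewrite big_ord_recl /= -E addrC subrK.
by exists (c 0%N); apply/IH; exists (c \o succn); rewrite big_ord_recl addrC addKr.
Qed.

Lemma indepP s :
  indep s <-> forall c : nat -> k, \sum_(i < size s) iota (c i) * s`_i = 0 ->
                forall i, (i < size s)%N -> c i = 0.
Proof.
elim: s => [|x s IH] //=; split=> [[hx /IH hs] c|h].
  rewrite big_ord_recl /= => E.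
  have c0 : c 0%N = 0.
    apply: hx; apply/in_spanP; exists (fun i => - c i.+1).
    under eq_bigr do rewrite rmorphN mulNr.
    by rewrite sumrN; apply/eqP; rewrite -addr_eq0 E.
  case=> [//|i]; move: E; rewrite c0 rmorph0 mul0r add0r.
  by move=> /(hs (c \o succn)) /(_ i).
split=> [a /in_spanP[c E]|].
  apply: (h (fun i => if i is j.+1 then - c j else a) _ 0%N) => //.
  rewrite big_ord_recl /= E.
  by under [X in _ + X]eq_bigr do rewrite rmorphN mulNr; rewrite sumrN subrr.
apply/IH => c E i si.
apply: (h (fun i => if i is j.+1 then c j else 0) _ i.+1 si).
by rewrite big_ord_recl /= rmorph0 mul0r add0r.
Qed.

Lemma indep_neq0 x s : indep (x :: s) -> x != 0.
Proof.
case=> h _; apply/eqP => x0; have /eqP := oner_neq0 k; apply.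
by apply: h; rewrite x0 mulr0; case: (in_span_submod s).
Qed.

Lemma has_indepW W m n : (n <= m)%N -> has_indep W m -> has_indep W n.
Proof.
elim: m => [|m IH]; first by rewrite leqn0 => /eqP ->.
rewrite leq_eqVlt => /predU1P[-> //|nm] [[|x s] [//= [ss] Ws [_ fs]]].
apply: IH => //; exists s; split=> // y ys; apply: Ws.
by rewrite inE ys orbT.
Qed.

Lemma has_indepS W W' m :
  (forall a, W a -> W' a) -> has_indep W m -> has_indep W' m.
Proof. by move=> WW' [s [sz Ws fs]]; exists s; split=> // x /Ws/WW'. Qed.

Lemma exists_rank W m : ~ has_indep W m ->
  exists r, has_indep W r /\ ~ has_indep W r.+1.
Proof.
elim: m => [[]|m IH nh]; first by exists [::].
by have [h|/IH//] := pselect (has_indep W m); exists m.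
Qed.

Lemma max_indep W m : ~ has_indep W m ->
  exists t, [/\ (size t < m)%N, (forall x, x \in t -> W x), indep t &
    forall w, W w -> exists2 c, c != 0 & in_span t (iota c * w)].
Proof.
elim: m => [|m IH] nh; first by case: nh; exists [::].
have [[t [sz Wt ft]]|/IH[t [sz Wt ft h]]] := pselect (has_indep W m); last first.
  by exists t; split=> //; rewrite ltnW.
exists t; split=> //; first by rewrite sz.
move=> w Ww; apply: contrapT => no; apply: nh; exists (w :: t); split.
- by rewrite /= sz.
- by move=> x; rewrite inE => /predU1P[->//|/Wt].
- split=> // c h; apply/eqP; apply: contrapT => /negP c0.
  by apply: no; exists c.
Qed.

End Span.

Lemma exists_lker (k : idomainType) m n (A : 'M[k]_(m, n)) :
  (n < m)%N -> exists2 v : 'rV_m, v != 0 & v *m A = 0.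
Proof.
move=> nm; have [p Em] : exists p, m = (n + p.+1)%N by exists (m - n.+1)%N; lia.
move: A; rewrite {}Em => A; have /det0P[v v0 /eqP] : \det (row_mx A 0) == 0.
  rewrite (expand_det_col _ (rshift n ord0)) big1 // => i _.
  by rewrite row_mxEr mxE mul0r.
by rewrite mul_mx_row row_mx_eq0 => /andP[/eqP vA _]; exists v.
Qed.

Lemma indep_size_le (k : idomainType) (R : nzRingType) (iota : {rmorphism k -> R})
    (s t : seq R) : indep iota s ->
  (forall x, x \in s -> exists2 c, c != 0 & in_span iota t (iota c * x)) ->
  (size s <= size t)%N.
Proof.
move=> /indepP fs st; rewrite leqNgt; apply/negP => ts.
have /choice[c hc] (i : 'I_(size s)) : exists c : k * (nat -> k),
    c.1 != 0 /\ iota c.1 * s`_i = \sum_(j < size t) iota (c.2 j) * t`_j.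
  have [//|a a0 /in_spanP[c E]] := st s`_i; first exact: mem_nth.
  by exists (a, c).
have [v /negP v0 vA] := exists_lker (\matrix_(i < size s, j < size t) (c i).2 j) ts.
pose b i := if insub i is Some j then v 0 j * (c j).1 else 0.
have bE (i : 'I_(size s)) : b i = v 0 i * (c i).1 by rewrite /b valK.
apply: v0; apply/eqP/rowP => i; rewrite mxE; apply/eqP.
have /eqP : b i = 0; last by rewrite bE mulf_eq0 (negPf (hc i).1) orbF.
apply: fs => //; under eq_bigr => j _ do rewrite bE rmorphM -mulrA (hc j).2 mulr_sumr.
rewrite exchange_big big1 //= => j _.
under eq_bigr do rewrite mulrA -rmorphM; rewrite -mulr_suml -rmorph_sum.
have /rowP/(_ j) := vA; rewrite !mxE; under eq_bigr do rewrite mxE.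
by move=> ->; rewrite rmorph0 mul0r.
Qed.

Lemma has_indep_span_le (k : idomainType) (R : nzRingType)
    (iota : {rmorphism k -> R}) s m :
  has_indep iota (in_span iota s) m -> (m <= size s)%N.
Proof.
case=> t [<- ht ft]; apply: (indep_size_le ft) => x /ht hx.
by exists 1; rewrite ?oner_neq0 // rmorph1 mul1r.
Qed.

Lemma indep_mul (k : nzRingType) (R : idomainType) (iota : {rmorphism k -> R}) a s :
  a != 0 -> indep iota s -> indep iota [seq a * x | x <- s].
Proof.
move=> a0 /indepP fs; apply/indepP => c; rewrite size_map => E i si.
apply: fs si; apply: (mulfI a0); rewrite mulr0 mulr_sumr -[RHS]E.
by apply: eq_bigr => j _; rewrite (nth_map 0) // mulrCA.
Qed.

(** * Leaves at a generic point *)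

Section Evaluation.
Context (k : nzRingType) (R : comNzRingType) (iota : {rmorphism k -> R}) (x : R).

Let comm_iota : commr_rmorph iota x.
Proof. by move=> y; exact: mulrC. Qed.

Definition evm : {rmorphism {poly k} -> R} := horner_morph comm_iota.

Lemma evmE p : evm p = (map_poly iota p).[x].
Proof. by []. Qed.

Lemma evmC c : evm c%:P = iota c.
Proof. exact: horner_morphC. Qed.

Lemma evmX : evm 'X = x.
Proof. exact: horner_morphX. Qed.

End Evaluation.

Section Leaves.
Context (k R : idomainType) (iota : {rmorphism k -> R}) (x : R).
Implicit Types (W : R -> Prop) (p q : {poly R}).

Local Notation Y := ('X - x%:P).
Local Notation iotaT := (map_poly iota).
Local Notation iotax := (evm iota x).

Definition poly_in W p : Prop := forall i, W p`_i.

Definition vanishing W (j : nat) p : Prop := poly_in W p /\ exists r, p = r * Y ^+ j.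

(* The leading coefficients at [T = x] of the elements of [vanishing W j]. *)
Definition leaf W (j : nat) (a : R) : Prop :=
  exists2 r, poly_in W (r * Y ^+ j) & r.[x] = a.

Lemma poly_inS W W' p : (forall a, W a -> W' a) -> poly_in W p -> poly_in W' p.
Proof. by move=> WW' Wp i; exact: WW'. Qed.

Lemma submod_poly_in W : submod iota W -> submod iotaT (poly_in W).
Proof.
move=> sW; case: (sW) => W0 WD WZ; split.
- by move=> i; rewrite coef0.
- by move=> p q Wp Wq i; rewrite coefD; exact: WD.
- move=> c p Wp i; rewrite coefM; apply: (submod_sum _ sW) => j _.
  by rewrite coef_map; exact: WZ.
Qed.

Lemma submod_multiple (q : {poly R}) : submod iotaT (fun p => exists r, p = r * q).
Proof.
split; first by exists 0; rewrite mul0r.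
- by move=> _ _ [r ->] [r' ->]; exists (r + r'); rewrite mulrDl.
- by move=> c _ [r ->]; exists (iotaT c * r); rewrite mulrA.
Qed.

Lemma submod_leaf W j : submod iota W -> submod iotax (leaf W j).
Proof.
move=> /submod_poly_in[W0 WD WZ]; split.
- by exists 0; rewrite ?horner0 ?mul0r.
- move=> a b [r Wr <-] [r' Wr' <-]; exists (r + r'); last by rewrite hornerD.
  by rewrite mulrDl; exact: WD.
- move=> c a [r Wr <-]; exists (iotaT c * r); last by rewrite hornerM.
  by rewrite -mulrA; exact: WZ.
Qed.

Lemma has_indep_polyC W m : submod iota W ->
  has_indep iota W m -> has_indep iotaT (poly_in W) m.
Proof.
move=> [W0 _ _] [s [<- Ws fs]]; exists (map polyC s); split; first by rewrite size_map.
  by move=> _ /mapP[y ys ->] i; rewrite coefC; case: eqP => // _; exact: Ws.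
apply/indepP => c; rewrite size_map => E i si; apply/polyP => d; rewrite coef0.
move: i si; move/indepP: fs => /(_ (fun i => (c i)`_d)); apply.
have := congr1 (coefp d) E; rewrite raddf_sum /= coef0 => Ed.
rewrite -[RHS]Ed; apply: eq_bigr => j _.
by rewrite (nth_map 0) // coefMC coef_map.
Qed.

Lemma in_span_polyC s y : in_span iota s y -> in_span iotaT (map polyC s) y%:P.
Proof.
elim: s y => [|z s IH] y /=; first by move->.
by case=> c h; exists c%:P; rewrite map_polyC -polyCM -polyCB; exact: IH.
Qed.

Lemma has_indep_poly_in W m : has_indep iotaT (poly_in W) m -> has_indep iota W m.
Proof.
move=> [qs [szq Wq fq]]; apply: contrapT => /max_indep[t [szt Wt ft ht]].
suff : (size qs <= size (map polyC t))%N by rewrite szq size_map leqNgt szt.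
apply: (indep_size_le fq) => q /Wq {}Wq.
have [sp0 spD spZ] := in_span_submod iotaT (map polyC t).
rewrite -[q]coefK poly_def; elim: (size q) => [|n [c c0 hc]].
  by exists 1; rewrite ?oner_neq0 // big_ord0 mulr0.
have [d d0 hd] := ht _ (Wq n).
exists (d%:P * c); first by rewrite mulf_neq0 // polyC_eq0.
rewrite big_ord_recr /= mulrDr rmorphM /=; apply: spD.
  by rewrite -mulrA; exact: (spZ d%:P).
have -> : map_poly iota d%:P * iotaT c * (q`_n *: 'X^n) =
    iotaT (c * 'X^n) * (iota d * q`_n)%:P.
  by rewrite rmorphM /= map_polyC map_polyXn -mul_polyC polyCM /=; ring.
exact/spZ/in_span_polyC.
Qed.

Lemma in_span_horner (ps : seq {poly R}) a :
  in_span iotax [seq p.[x] | p <- ps] a <->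
  exists2 g, in_span iotaT ps g & g.[x] = a.
Proof.
elim: ps a => [|p ps IH] a /=.
  by split=> [->|[g ->]]; [exists 0|]; rewrite ?horner0.
split=> [[c /IH[g sg E]]|[g [c sg] <-]]; last first.
  by exists c; apply/IH; exists (g - iotaT c * p); rewrite // hornerD hornerN hornerM.
exists (g + iotaT c * p); first by exists c; rewrite addrK.
by rewrite hornerD hornerM E -evmE subrK.
Qed.

Lemma multiple_root (q r : {poly R}) j :
  q * Y ^+ j = r * Y ^+ j.+1 -> q.[x] = 0.
Proof.
rewrite exprS mulrA => /mulIf ->; first by rewrite hornerM hornerXsubC subrr mulr0.
by rewrite expf_neq0 // polyXsubC_eq0.
Qed.

Lemma in_span_leading j (ps qs : seq {poly R}) q :
  (forall p, p \in qs -> exists r, p = r * Y ^+ j.+1) ->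
  in_span iotaT ([seq p * Y ^+ j | p <- ps] ++ qs) (q * Y ^+ j) ->
  in_span iotax [seq p.[x] | p <- ps] q.[x].
Proof.
move=> qsY; elim: ps q => [|p ps IH] q /=.
  by move=> /(in_span_min (submod_multiple _) qsY)[r /multiple_root].
case=> c h; exists c; rewrite evmE -hornerM -[- _]hornerN -hornerD.
by apply: IH; rewrite mulrBl -mulrA.
Qed.

Lemma indep_leading j (ps qs : seq {poly R}) :
  (forall q, q \in qs -> exists r, q = r * Y ^+ j.+1) ->
  indep iotax [seq p.[x] | p <- ps] -> indep iotaT qs ->
  indep iotaT ([seq p * Y ^+ j | p <- ps] ++ qs).
Proof.
move=> qsY + fq; elim: ps => [//|p ps IH] /= [hp /IH fps]; split=> // c.
by rewrite mulrA => /(in_span_leading qsY); rewrite hornerM; exact: hp.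
Qed.

Lemma has_indep_vanishing W j m n : has_indep iotax (leaf W j) m ->
  has_indep iotaT (vanishing W j.+1) n -> has_indep iotaT (vanishing W j) (m + n).
Proof.
move=> [ts [<- /map_preimage[ps <- Wps] fp]] [qs [<- Wqs fq]].
exists ([seq p * Y ^+ j | p <- ps] ++ qs); split.
- by rewrite size_cat !size_map.
- move=> q; rewrite mem_cat => /orP[/mapP[p /Wps Wp ->]|/Wqs[Wq [r Er]]]; split=> //.
    by exists p.
  by exists (r * Y); rewrite Er exprS mulrA.
- by apply: indep_leading fp fq => q /Wqs[].
Qed.

Lemma has_indep_leaf W j m n : submod iota W ->
  has_indep iotaT (vanishing W j) m -> ~ has_indep iotaT (vanishing W j.+1) n.+1 ->
  has_indep iotax (leaf W j) (m - n).
Proof.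
move=> sW [s [<- Ws fs]] /max_indep[us [szu _ _ hu]].
apply: contrapT => /max_indep[ts [szt Wt _ ht]].
have [ps Eps Wps] := map_preimage Wt; rewrite -{}Eps in ht szt.
suff : (size s <= size ([seq (p * Y ^+ j)%R | p <- ps] ++ us))%N.
  rewrite leqNgt size_cat size_map; move: szt.
  by rewrite size_map ltn_subRL => /(leq_ltn_trans _)->//; rewrite addnC leq_add2r.
apply: (indep_size_le fs) => q /Ws[Wq [r Eq]].
have [|c c0 /in_span_horner[g gps Eg]] := ht r.[x]; first by exists r; rewrite -?Eq.
have /factor_theorem[r' Er'] : root (iotaT c * r - g) x.
  by rewrite rootE hornerD hornerM hornerN Eg subrr.
have [_ _ PZ] := submod_poly_in sW; have gY := in_span_mulr (Y ^+ j) gps.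
have Wg : poly_in W (g * Y ^+ j).
  by apply: (in_span_min (submod_poly_in sW)) gY => _ /mapP[p ps_p ->]; exact: Wps.
have [|d d0 hd] := hu (iotaT c * q - g * Y ^+ j).
  split; first by apply: (submodB (submod_poly_in sW)) => //; exact: PZ.
  by exists r'; rewrite exprS mulrA -Er' mulrBl Eq mulrA.
exists (d * c); first exact: mulf_neq0.
have [_ SD SZ] := in_span_submod iotaT ([seq p * Y ^+ j | p <- ps] ++ us).
rewrite -[_ * q](subrK (iotaT d * (g * Y ^+ j))); apply: SD.
  rewrite rmorphM -mulrA -mulrBr; apply: in_spanS hd => z zu.
  by rewrite mem_cat zu orbT.
by apply/SZ/(in_spanS _ gY) => z zps; rewrite mem_cat zps.
Qed.

Lemma leaves_glue W (m : nat -> nat) n :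
  (forall j, (j < n)%N -> has_indep iotax (leaf W j) (m j)) ->
  has_indep iota W (\sum_(j < n) m j).
Proof.
move=> hl; apply: has_indep_poly_in.
suff h l i : (i + l <= n)%N ->
    has_indep iotaT (vanishing W i) (\sum_(j < l) m (i + j)%N).
  by apply: has_indepS (h n 0%N (leqnn n)) => p [].
elim: l i => [|l IH] i le; first by rewrite big_ord0; exists [::].
rewrite big_ord_recl addn0; apply: has_indep_vanishing; first by apply: hl; lia.
under eq_bigr do rewrite /= /bump /= add1n addnS -addSn.
by apply: IH; lia.
Qed.

Hypothesis x_transc : injective iotax.

(* Once the rank is minimal, every element of [vanishing W n] has a multiple
   in [vanishing W j], for each [j]; but a nonzero polynomial vanishes to a
   finite order at the transcendental point [x], and so do its multiples. *)
Lemma rank_vanishing_eq0 W (r : nat -> nat) :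
  (forall j, has_indep iotaT (vanishing W j) (r j) /\
             ~ has_indep iotaT (vanishing W j) (r j).+1) ->
  exists n, r n = 0%N.
Proof.
move=> hr; have [n rn_min] := exists_argmin r 0%N.
exists n; apply/eqP; rewrite -leqn0 leqNgt; apply/negP => rn0.
have [[[|p s] [szs Wps fps]] max_rn] := hr n; first by rewrite -szs in rn0.
have [Wp [q Eq]] := Wps p (mem_head _ _).
have [u [v /implyP/(_ (indep_neq0 fps)) vx Ev]] := multiplicity_XsubC p x.
have [t [szt Wt ft]] := has_indepW (rn_min (maxn n u.+1)) (hr (maxn n u.+1)).1.
apply: max_rn; exists (p :: t); split; first by rewrite /= szt.
  move=> z; rewrite inE => /predU1P[->|/Wt[Wz [w Ez]]]; first by split=> //; exists q.
  split=> //; exists (w * Y ^+ (maxn n u.+1 - n)).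
  by rewrite -mulrA -exprD subnK // leq_maxl.
split=> // c h; apply: x_transc; rewrite rmorph0; apply/eqP.
have /(in_span_min (submod_multiple (Y ^+ u.+1)))/(_ h)[w Ew] z :
    z \in t -> exists w, z = w * Y ^+ u.+1.
  case/Wt => _ [w ->]; exists (w * Y ^+ (maxn n u.+1 - u.+1)).
  by rewrite -mulrA -exprD subnK // leq_maxr.
have /eqP : (iotaT c * v).[x] = 0 by apply: (@multiple_root _ w u); rewrite -mulrA -Ev.
by rewrite hornerM mulf_eq0 -[v.[x] == 0]/(root v x) (negPf vx) orbF.
Qed.

Lemma leaves_split V m : submod iota V -> has_indep iota V m ->
  exists n (l : nat -> nat), (m <= \sum_(j < n) l j)%N /\
    forall j, has_indep iotax (leaf V j) (l j).
Proof.
move=> sV [s [<- Vs fs]]; pose W := in_span iota s.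
have sW : submod iota W := in_span_submod iota s.
have /choice[r hr] j : exists r, has_indep iotaT (vanishing W j) r /\
    ~ has_indep iotaT (vanishing W j) r.+1.
  apply: (@exists_rank _ _ _ _ (size s).+1) => h.
  have : has_indep iotaT (poly_in W) (size s).+1 by apply: has_indepS h => p [].
  by move=> /has_indep_poly_in /has_indep_span_le; rewrite ltnn.
have [n rn] := rank_vanishing_eq0 hr.
exists n, (fun j => r j - r j.+1)%N; split; last first.
  move=> j; apply: (@has_indepS _ _ _ (leaf W j)).
    by move=> _ [q Wq <-]; exists q => //; apply: poly_inS Wq => a; exact: in_span_min.
  by apply: has_indep_leaf => //; [exact: (hr j).1|exact: (hr j.+1).2].
have le_r0 : (size s <= r 0%N)%N.
  rewrite leqNgt; apply/negP => lt; apply: (hr 0%N).2; apply: has_indepW lt _.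
  apply: (@has_indepS _ _ _ (poly_in W)).
    by move=> p Wp; split=> //; exists p; rewrite expr0 mulr1.
  by apply: has_indep_polyC => //; exists s; split=> // y; exact: mem_in_span.
suff : (r 0 <= \sum_(j < n) (r j - r j.+1) + r n)%N by rewrite rn addn0; exact: leq_trans.
elim: (n) => [|i IH]; first by rewrite big_ord0.
apply: leq_trans IH _.
by rewrite big_ord_recr /= -addnA leq_add2l addnC -leq_subLR.
Qed.

End Leaves.

(** * Superadditivity of ranks *)

Lemma sum_nat_divn (g : nat -> nat) n N : (0 < N)%N ->
  (\sum_(w < n * N) g (w %/ N) = N * \sum_(j < n) g j)%N.
Proof.
move=> N0; elim: n => [|n IH]; first by rewrite mul0n !big_ord0 muln0.
rewrite big_ord_recr /= mulnDr -IH mulSnr big_split_ord /=; congr addn.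
under eq_bigr => i _ do rewrite divnMDl // (divn_small (ltn_ord i)) addn0.
by rewrite sum_nat_const card_ord.
Qed.

Section Superadditivity.
Context (R : idomainType).
Implicit Types (k : idomainType) (V W X : R -> Prop) (xs : seq R).

(* The evaluation [k[T_1]...[T_n] -> R] is injective. *)
Fixpoint alg_indep xs : forall k, {rmorphism k -> R} -> Prop :=
  if xs is x :: xs' then fun k iota => alg_indep xs' (evm iota x)
  else fun k iota => injective iota.

Fixpoint monom_lt (N : nat) xs (a : R) : Prop :=
  if xs is x :: xs' then
    exists b a', [/\ (b < N)%N, monom_lt N xs' a' & a = x ^+ b * a']
  else a = 1.

Lemma alg_indep_inj xs k (iota : {rmorphism k -> R}) :
  alg_indep xs iota -> injective iota.
Proof.
elim: xs k iota => [//|x xs IH] k iota /= /IH h a b E.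
by apply: polyC_inj; apply: h; rewrite !evmC.
Qed.

Section PolynomialPowers.
Context (k : idomainType) (iota : {rmorphism k -> R}).

Lemma submod_pow_colon N V W : submod iota W -> submod iota (pow_colon N V W).
Proof.
case=> W0 WD WZ; split.
- by move=> es _ _; rewrite mulr0.
- by move=> a b Wa Wb es ses Ves; rewrite mulrDr; apply: WD; [exact: Wa|exact: Wb].
- by move=> c a Wa es ses Ves; rewrite mulrCA; apply: WZ; exact: Wa.
Qed.

Lemma pow_mul_sub_poly N V X W : submod iota W -> pow_mul_sub N V X W ->
  pow_mul_sub N (poly_in V) (poly_in X) (poly_in W).
Proof.
move=> sW; elim: N X => [|N IH] X hX q Xq [|p ps] //=.
  rewrite big_nil mul1r => _ _ i; have := hX _ (Xq i) [::].
  by rewrite big_nil mul1r; apply.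
move=> [sps] Vps; rewrite big_cons [p * _]mulrC -mulrA.
apply: (IH (pow_colon N V W)) => // [i|e eps]; last by apply: Vps; rewrite inE eps orbT.
rewrite coefM; apply: (submod_sum _ (submod_pow_colon N V sW)) => j _ es ses Ves.
rewrite mulrCA; apply: pow_colonS es ses Ves => //; last exact: hX.
exact: (Vps p (mem_head _ _)).
Qed.

Lemma poly_in_XsubC_exp W (x : R) u : submod iota W ->
  (forall b, (b <= u)%N -> W (x ^+ b)) -> poly_in W (('X - x%:P) ^+ u).
Proof.
elim: u W => [|u IH] W sW hW i.
  rewrite expr0 coef1; case: eqP => _; last by case: sW.
  by have := hW 0%N isT; rewrite expr0.
rewrite exprS mulrBl coefB coefXM mul_polyC coefZ; apply: (submodB sW).
  case: eqP => _; first by case: sW.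
  by apply: IH => // b bu; apply: hW; exact: leqW.
apply: (IH (fun a => W (x * a))).
  case: sW => W0 WD WZ; split; first by rewrite mulr0.
    by move=> a b ha hb; rewrite mulrDr; exact: WD.
  by move=> c a ha; rewrite mulrCA; exact: WZ.
by move=> b bu; rewrite -exprS; exact: hW.
Qed.

Lemma pow_mul_sub_leaf x xs N j u V W : submod iota W -> (u < N)%N ->
  pow_mul_sub N V (monom_lt N (x :: xs)) W ->
  pow_mul_sub N (leaf x V j) (monom_lt N xs) (leaf x W (j * N + u)).
Proof.
move=> sW uN hVW a ma es ses /map_preimage[rs Ers Vrs]; rewrite -{es}Ers in ses *.
rewrite size_map in ses.
exists ((\prod_(r <- rs) r) * a%:P); last first.
  by rewrite hornerM hornerC big_map horner_prod.
have -> : \prod_(r <- rs) r * a%:P * ('X - x%:P) ^+ (j * N + u) =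
    (\prod_(p <- [seq r * ('X - x%:P) ^+ j | r <- rs]) p) * (a%:P * ('X - x%:P) ^+ u).
  rewrite big_map big_split /= prodrXr big_const_seq count_predT iter_addn_0 ses.
  by rewrite exprD; ring.
have sC := submod_pow_colon N V sW.
apply: (pow_mul_sub_poly (N := N) (X := pow_colon N V W) sW (fun _ => id)); first last.
- by move=> p /mapP[r hr ->]; exact: Vrs.
- by rewrite size_map.
move=> i; rewrite mul_polyC coefZ.
apply: (poly_in_XsubC_exp (W := fun b => pow_colon N V W (a * b))).
  case: sC => C0 CD CZ; split=> [|b c hb hc|c b hb]; rewrite ?mulr0 // ?mulrDr.
    exact: CD.
  by rewrite mulrCA; exact: CZ.
move=> b bu; apply: hVW; exists b, a; split=> //; last exact: mulrC.
exact: leq_ltn_trans uN.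
Qed.

End PolynomialPowers.

Lemma indep_power k (iota : {rmorphism k -> R}) N m V W : (0 < N)%N ->
  pow_mul_sub N V (fun a => a = 1) W -> has_indep iota V m -> has_indep iota W m.
Proof.
move=> N0 hVW [[|y s] [<- Vs fs]]; first by exists [::].
exists [seq y ^+ N.-1 * z | z <- y :: s]; split.
- by rewrite size_map.
- move=> _ /mapP[z zs ->].
  have := hVW _ erefl (z :: nseq N.-1 y); rewrite /= size_nseq prednK // mulr1.
  rewrite big_cons big_nseq iter_mulr_1 mulrC; apply=> // e.
  rewrite inE mem_nseq => /orP[/eqP ->|/andP[_ /eqP ->]]; apply: Vs => //.
  exact: mem_head.
- by apply: indep_mul => //; rewrite expf_neq0 // (indep_neq0 fs).
Qed.

(* For every [u < N], the leaf of order [j * N + u] of [W] contains the [N]-th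
   power of the leaf of order [j] of [V]. *)
Theorem indep_power_mul xs k (iota : {rmorphism k -> R}) N m V W :
  (0 < N)%N -> alg_indep xs iota -> submod iota V -> submod iota W ->
  has_indep iota V m -> pow_mul_sub N V (monom_lt N xs) W ->
  has_indep iota W (N ^ size xs * m).
Proof.
move=> N0; elim: xs k iota m V W => [|x xs IH] k iota m V W ai sV sW hV hVW.
  by rewrite expn0 mul1n; exact: indep_power hVW hV.
have evm_inj : injective (evm iota x) by exact: alg_indep_inj (ai : alg_indep xs _).
have [n [l [ml hl]]] := leaves_split evm_inj sV hV.
apply: (@has_indepW _ _ _ _ (\sum_(w < n * N) N ^ size xs * l (w %/ N))%N).
  by rewrite -big_distrr /= sum_nat_divn // mulnA -expnSr leq_mul2l ml orbT.
apply: (@leaves_glue _ _ iota x W (fun w => N ^ size xs * l (w %/ N))%N) => w _.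
apply: (IH _ _ _ (leaf x V (w %/ N)) (leaf x W w) ai) => //; try exact: submod_leaf.
rewrite [in leaf _ W _](divn_eq w N).
exact: pow_mul_sub_leaf sW (ltn_pmod w N0) hVW.
Qed.

End Superadditivity.

(** * Growth of finitely generated algebras *)

Section PolyLe.
Context (k R : comNzRingType) (iota : {rmorphism k -> R}).
Implicit Types (zs : seq R) (n m : nat).

Inductive poly_le zs : nat -> R -> Prop :=
| poly_le_const n c : poly_le zs n (iota c)
| poly_le_add n a b : poly_le zs n a -> poly_le zs n b -> poly_le zs n (a + b)
| poly_le_gen n z a : z \in zs -> poly_le zs n a -> poly_le zs n.+1 (z * a).

Lemma poly_le_mono zs zs' n m a :
  {subset zs <= zs'} -> (n <= m)%N -> poly_le zs n a -> poly_le zs' m a.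
Proof.
move=> sub le h; elim: h m le => {n a} [n c|n a b _ IHa _ IHb|n z a zz _ IH] m le.
- exact: poly_le_const.
- by apply: poly_le_add; [exact: IHa|exact: IHb].
- by case: m le => // m le; apply: poly_le_gen; [exact: sub|exact: IH].
Qed.

Lemma poly_le0 zs n : poly_le zs n 0.
Proof. by rewrite -(rmorph0 iota); exact: poly_le_const. Qed.

Lemma poly_le1 zs n : poly_le zs n 1.
Proof. by rewrite -(rmorph1 iota); exact: poly_le_const. Qed.

Lemma poly_le_scale zs n c a : poly_le zs n a -> poly_le zs n (iota c * a).
Proof.
elim=> {n a} [n d|n a b _ IHa _ IHb|n z a zz _ IH].
- by rewrite -rmorphM; exact: poly_le_const.
- by rewrite mulrDr; exact: poly_le_add.
- by rewrite mulrCA; exact: poly_le_gen.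
Qed.

Lemma poly_le_opp zs n a : poly_le zs n a -> poly_le zs n (- a).
Proof.
by move=> ha; rewrite -mulN1r -(rmorph1 iota) -rmorphN; exact: poly_le_scale.
Qed.

Lemma poly_le_mul zs n m a b :
  poly_le zs n a -> poly_le zs m b -> poly_le zs (n + m) (a * b).
Proof.
move=> ha hb; elim: ha => {n a} [n d|n a b' _ IHa _ IHb|n z a zz _ IH].
- by apply: poly_le_scale; apply: poly_le_mono hb => //; exact: leq_addl.
- by rewrite mulrDl; exact: poly_le_add.
- by rewrite -mulrA addSn; exact: poly_le_gen.
Qed.

Lemma poly_le_exp zs h m b : poly_le zs h b -> poly_le zs (m * h) (b ^+ m).
Proof.
move=> hb; elim: m => [|m IH]; last by rewrite exprS mulSn; exact: poly_le_mul.
by rewrite expr0; exact: poly_le1.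
Qed.

Lemma poly_le_mem zs z : z \in zs -> poly_le zs 1 z.
Proof.
by rewrite -[z in poly_le _ _ z]mulr1 => /poly_le_gen; apply; exact: poly_le1.
Qed.

End PolyLe.

Lemma poly_le_evm (k R : comNzRingType) (iota : {rmorphism k -> R}) x xs h b :
  poly_le (evm iota x) xs h b -> exists h', poly_le iota (x :: xs) h' b.
Proof.
elim=> {h b} [_ c|_ a b _ [ha IHa] _ [hb IHb]|_ z a zz _ [h IH]].
- elim/poly_ind: c => [|p c [h IH]].
    by exists 0%N; rewrite rmorph0; exact: poly_le0.
  exists h.+1; rewrite rmorphD rmorphM; apply: poly_le_add.
    rewrite evmX mulrC; apply: poly_le_gen; first exact: mem_head.
    exact: IH.
  by rewrite evmC; exact: poly_le_const.
- exists (maxn ha hb); apply: poly_le_add.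
    by apply: poly_le_mono IHa => //; exact: leq_maxl.
  by apply: poly_le_mono IHb => //; exact: leq_maxr.
- by exists h.+1; apply: poly_le_gen => //; rewrite inE zz orbT.
Qed.

Section Growth.
Context (R : idomainType).
Implicit Types (k : idomainType) (zs : seq R).

Lemma alg_dependence xs z k (iota : {rmorphism k -> R}) :
  alg_indep xs iota -> ~ alg_indep (rcons xs z) iota ->
  exists (p : {poly R}) h, [/\ (forall i, poly_le iota xs h p`_i), p != 0 & root p z].
Proof.
elim: xs k iota => [|x xs IH] k iota /=.
  move=> iota_inj /existsNP[p /existsNP[q /not_implyP[Epq /eqP pq]]].
  exists (map_poly iota (p - q)), 0%N; split.
  - by move=> i; rewrite coef_map; exact: poly_le_const.
  - rewrite map_poly_eq0_id0 -?(rmorph0 iota) ?(inj_eq iota_inj) ?lead_coef_eq0;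
      by rewrite subr_eq0.
  - by rewrite rootE -evmE rmorphB subr_eq0; exact/eqP.
move=> /IH /[apply] -[p [h [hp p0 pz]]].
suff [h' hp'] : exists h', forall i, (i < size p)%N -> poly_le iota (x :: xs) h' p`_i.
  exists p, h'; split=> // i; have [/hp'//|le] := ltnP i (size p).
  by rewrite nth_default //; exact: poly_le0.
elim: (size p) => [|n [h' hp']]; first by exists 0%N.
have [hn hpn] := poly_le_evm (hp n).
exists (maxn h' hn) => i; rewrite ltnS leq_eqVlt => /predU1P[->|lt].
  by apply: poly_le_mono hpn => //; exact: leq_maxr.
by apply: poly_le_mono (hp' i lt) => //; exact: leq_maxl.
Qed.

Section AddGenerator.
Context (k : idomainType) (iota : {rmorphism k -> R}) (z : R) (zs : seq R).

Definition horner_le e n (y : R) : Prop := exists q : {poly R},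
  [/\ (size q <= e)%N, (forall i, poly_le iota zs n q`_i) & q.[z] = y].

Lemma horner_le_mono e e' n n' y : (e <= e')%N -> (n <= n')%N ->
  horner_le e n y -> horner_le e' n' y.
Proof.
move=> le le' [q [sq hq <-]]; exists q; split=> //; first exact: leq_trans le.
by move=> i; exact: poly_le_mono (hq i).
Qed.

Lemma horner_leD e n y y' :
  horner_le e n y -> horner_le e n y' -> horner_le e n (y + y').
Proof.
move=> [q [sq hq <-]] [q' [sq' hq' <-]]; exists (q + q'); split.
- by apply: leq_trans (size_polyD _ _) _; rewrite geq_max sq.
- by move=> i; rewrite coefD; exact: poly_le_add.
- exact: hornerD.
Qed.

Lemma horner_leC e n c : (0 < e)%N -> poly_le iota zs n c -> horner_le e n c.
Proof.
move=> e0 hc; exists c%:P; rewrite hornerC; split=> // [|i].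
  exact: leq_trans (size_polyC_leq1 c) e0.
by rewrite coefC; case: eqP => // _; exact: poly_le0.
Qed.

Lemma horner_leZ e n m c y :
  poly_le iota zs m c -> horner_le e n y -> horner_le e (m + n) (c * y).
Proof.
move=> hc [q [sq hq <-]]; exists (c *: q); split; last exact: hornerZ.
- exact: leq_trans (size_scale_leq _ _) sq.
- by move=> i; rewrite coefZ; exact: poly_le_mul.
Qed.

Lemma horner_leMX e n y : horner_le e n y -> horner_le e.+1 n (z * y).
Proof.
case=> q [sq hq <-]; exists (q * 'X); split; last by rewrite hornerMX mulrC.
- by apply: leq_trans (size_polyMleq _ _) _; rewrite size_polyX addn2.
- by move=> i; rewrite coefMX; case: eqP => // _; exact: poly_le0.
Qed.

(* Euclidean division by [p], after multiplication by the leading coefficient. *)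
Lemma horner_le_reduce (p : {poly R}) e h n y : size p = e.+1 ->
  (forall i, poly_le iota zs h p`_i) -> root p z ->
  horner_le e.+1 n y -> horner_le e (h + n) (lead_coef p * y).
Proof.
move=> sp hp /rootP pz [q [sq hq <-]].
exists (lead_coef p *: q - q`_e *: p); split.
- apply/leq_sizeP => i; rewrite leq_eqVlt coefB !coefZ lead_coefE sp /=.
  move=> /predU1P[<-|lt]; first by rewrite mulrC subrr.
  by rewrite (nth_default _ (leq_trans sq lt)) [p`_i]nth_default ?sp // !mulr0 subrr.
- move=> i; rewrite coefB !coefZ; apply: poly_le_add.
    by apply: poly_le_mul (hq i); exact: hp.
  by rewrite addnC; apply/poly_le_opp/poly_le_mul.
- by rewrite hornerD hornerN !hornerZ pz mulr0 subr0.
Qed.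

Lemma in_span_horner_le e n g (t : seq R) y :
  (forall p, poly_le iota zs n p -> in_span iota t (g * p)) ->
  horner_le e n y ->
  in_span iota [seq a * z ^+ i | a <- t, i <- seq.iota 0 e] (g * y).
Proof.
move=> ht [q [sq hq <-]]; rewrite (horner_coef_wide z sq) mulr_sumr.
apply: (submod_sum _ (in_span_submod iota _)) => i _; rewrite mulrA.
apply: in_spanS (in_span_mulr _ (ht _ (hq i))) => _ /mapP[a at_ ->].
by apply/allpairsP; exists (a, val i); rewrite mem_iota ltn_ord.
Qed.

End AddGenerator.

Definition growth_bound k (iota : {rmorphism k -> R}) zs (d C : nat) : Prop :=
  forall n, exists g t, [/\ g != 0, (size t <= C * n.+1 ^ d)%N &
    forall p, poly_le iota zs n p -> in_span iota t (g * p)].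

Section GrowthBound.
Context (k : idomainType) (iota : {rmorphism k -> R}).

Lemma growth_bound_nil : growth_bound iota [::] 0 1.
Proof.
move=> n; exists 1, [:: 1]; split=> //; first exact: oner_neq0.
move=> p h; rewrite mul1r; elim: h => {n p} [n c|n a b _ IHa _ IHb|//].
  by exists c; rewrite mulr1 subrr.
by case: (in_span_submod iota [:: 1]) => _ SD _; exact: SD.
Qed.

Lemma growth_bound_cons z zs d C :
  growth_bound iota zs d C -> growth_bound iota (z :: zs) d.+1 C.
Proof.
move=> hC n; have [g [t [g0 st ht]]] := hC n.
exists g, [seq a * z ^+ i | a <- t, i <- seq.iota 0 n.+1]; split=> //.
  by rewrite size_allpairs size_iota expnSr mulnA leq_mul2r st orbT.
move=> p hp; apply: in_span_horner_le ht _.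
elim: hp => {p g t g0 st} [m c|m a a' _ IHa _ IHb|m y a yz _ IH].
- by apply: horner_leC => //; exact: poly_le_const.
- exact: horner_leD.
- move: yz; rewrite inE => /predU1P[->|/(poly_le_mem iota) hy].
    by apply: horner_le_mono (horner_leMX IH).
  exact: horner_le_mono (horner_leZ hy IH).
Qed.

(* Each of the at most [m] factors [z] costs one division by [p]. *)
Lemma poly_le_alg z zs (p : {poly R}) e h m y : size p = e.+2 ->
  (forall i, poly_le iota zs h p`_i) -> root p z -> poly_le iota (z :: zs) m y ->
  horner_le iota z zs e.+1 (m * h.+1) (lead_coef p ^+ m * y).
Proof.
move=> sp hp pz; elim=> {m y} [m c|m a a' _ IHa _ IHb|m y a yz _ IH].
- apply: horner_leC => //; rewrite mulrC; apply: poly_le_scale.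
  by apply: poly_le_mono (poly_le_exp m (hp _)) => //; rewrite leq_mul2l leqnSn orbT.
- by rewrite mulrDr; exact: horner_leD.
- rewrite exprS mulSn; move: yz; rewrite inE => /predU1P[->|yzs].
    rewrite -mulrA [_ ^+ m * _]mulrCA.
    have := horner_le_reduce sp hp pz (horner_leMX IH).
    by apply: horner_le_mono => //; rewrite leq_add2r.
  rewrite [_ * (y * a)]mulrACA [lead_coef p * y]mulrC.
  by apply: horner_leZ IH; apply: poly_le_gen => //; exact: hp.
Qed.

Lemma growth_bound_alg z zs d C (p : {poly R}) h : growth_bound iota zs d C ->
  (forall i, poly_le iota zs h p`_i) -> p != 0 -> root p z ->
  exists C', growth_bound iota (z :: zs) d C'.
Proof.
move=> hC hp p0 pz; have [e sp] : exists e, size p = e.+2.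
  by have := root_size_gt1 p0 pz; case: (size p) => [|[|e]] // _; exists e.
exists (e.+1 * C * h.+1 ^ d)%N => n; have [g [t [g0 st ht]]] := hC (n * h.+1)%N.
exists (g * lead_coef p ^+ n), [seq a * z ^+ i | a <- t, i <- seq.iota 0 e.+1].
split=> [||y hy].
- by rewrite mulf_neq0 // expf_neq0 // lead_coef_eq0.
- rewrite size_allpairs size_iota mulnC -!mulnA leq_mul2l /=.
  apply: leq_trans st _; rewrite leq_mul2l -expnMn; apply/orP; right.
  by case: (d) => [//|d']; rewrite leq_exp2r //; nia.
- rewrite -mulrA; apply: in_span_horner_le ht _; exact: poly_le_alg sp hp pz hy.
Qed.

End GrowthBound.

Theorem growth k (iota : {rmorphism k -> R}) zs : injective iota ->
  exists xs C, [/\ {subset xs <= zs}, alg_indep xs iota &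
    growth_bound iota zs (size xs) C].
Proof.
move=> iota_inj; elim: zs => [|z zs [xs [C [xs_zs xs_indep hC]]]].
  by exists [::], 1%N; split=> //; exact: growth_bound_nil.
have zs_zzs : {subset zs <= z :: zs} by move=> y hy; rewrite inE hy orbT.
have [indep_z|/(alg_dependence xs_indep)[p [h [hp p0 pz]]]] :=
    pselect (alg_indep (rcons xs z) iota).
- exists (rcons xs z), C; split=> //; last first.
    by rewrite size_rcons; exact: growth_bound_cons.
  by move=> y; rewrite mem_rcons !inE => /predU1P[->|/xs_zs ->]; rewrite ?eqxx ?orbT.
- have [|C' hC'] := growth_bound_alg hC _ p0 pz (h := h).
    by move=> i; exact: poly_le_mono (hp i).
  by exists xs, C'; split=> // y /xs_zs/zs_zzs.
Qed.

End Growth.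

(** * Graded algebras *)

Section IntegralEmbedding.
Context (K : fieldType) (A : comAlgType K) (intA : integral_alg A).

Let unitA : pred A := fun x => `[< exists y, y * x = 1 >].

Let invA (x : A) : A :=
  if pselect (exists y, y * x = 1) is left h then projT1 (cid h) else x.

Let mulVA : {in unitA, left_inverse 1 invA *%R}.
Proof.
move=> x /asboolP h; rewrite /invA; case: pselect => // h'.
exact: projT2 (cid h').
Qed.

Let unitAP (x y : A) : y * x = 1 -> unitA x.
Proof. by move=> h; apply/asboolP; exists y. Qed.

Let invA_out : {in [predC unitA], invA =1 id}.
Proof.
by move=> x /negP h; rewrite /invA; case: pselect => // h'; case: h; apply/asboolP.
Qed.

Let mulA_eq0 (x y : A) : x * y = 0 -> (x == 0) || (y == 0).
Proof. by case/(intA.2) => ->; rewrite eqxx ?orbT. Qed.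

Let comUnitA : comUnitRingType := HB.pack (A : Type) (GRing.ComNzRing.class A)
  (@GRing.ComNzRing_hasMulInverse.Build A unitA invA mulVA unitAP invA_out).

Let domainA : idomainType :=
  HB.pack (A : Type) (GRing.ComUnitRing.class comUnitA)
    (@GRing.ComUnitRing_isIntegral.Build comUnitA mulA_eq0).

Let toD : {rmorphism A -> domainA} :=
  GRing.RMorphism.clone A domainA (idfun : A -> A) _.

Lemma integral_embedding :
  exists (Fr : fieldType) (phi : {rmorphism A -> Fr}), injective phi.
Proof.
exists {fraction domainA}, (@FracField.tofrac domainA \o toD) => x y /eqP /=.
by rewrite tofrac_eq => /eqP.
Qed.

End IntegralEmbedding.

Section Subspaces.
Context (K : fieldType) (A : lmodType K).
Implicit Types (V W : A -> Prop) (s : seq A).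

Lemma subspaceZ W c a : is_subspace W -> W a -> W (c *: a).
Proof. by case=> W0 WZ Wa; rewrite -[_ *: _]addr0; exact: WZ. Qed.

Lemma subspaceD W a b : is_subspace W -> W a -> W b -> W (a + b).
Proof. by case=> W0 WZ Wa Wb; rewrite -[a]scale1r; exact: WZ. Qed.

Lemma subspace_sum W (I : Type) (r : seq I) (P : pred I) (F : I -> A) :
  is_subspace W -> (forall i, P i -> W (F i)) -> W (\sum_(i <- r | P i) F i).
Proof.
move=> sW WF; apply: big_ind => //; first by case: sW.
by move=> a b; exact: subspaceD.
Qed.

Lemma lin_freeP s :
  lin_free s <-> forall c : nat -> K, \sum_(i < size s) c i *: s`_i = 0 ->
                   forall i, (i < size s)%N -> c i = 0.
Proof.
split=> [h c E i si|h c E i]; first exact: (h (c \o val) E (Ordinal si)).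
have := h (fun i => oapp c 0 (insub i)) _ i (ltn_ord i); rewrite valK; apply.
by rewrite -[RHS]E; apply: eq_bigr => j _; rewrite valK.
Qed.

Definition free_in W (m : nat) : Prop :=
  exists s, [/\ size s = m, (forall x, x \in s -> W x) & lin_free s].

End Subspaces.

Lemma subspace_mull (K : fieldType) (A : comAlgType K) (W : A -> Prop) (b : A) :
  is_subspace W -> is_subspace (fun x => W (b * x)).
Proof.
case=> W0 WZ; split; first by rewrite mulr0.
by move=> c u v hu hv; rewrite mulrDr -scalerAr; exact: WZ.
Qed.

Section ScalarMap.
Context (K : fieldType) (A : comAlgType K) (Fr : fieldType).
Context (phi : {rmorphism A -> Fr}) (phi_inj : injective phi).
Implicit Types (W : A -> Prop) (s : seq A).

Definition scalar_map : {rmorphism K -> Fr} := phi \o in_alg A.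

Definition image_div W (u w : Fr) : Prop := exists2 b, W b & phi b = w * u.

Lemma scalar_mapE c a : phi (c *: a) = scalar_map c * phi a.
Proof. by rewrite -[in LHS](mulr_algl c a) rmorphM. Qed.

Lemma lin_free_indep s : lin_free s <-> indep scalar_map (map phi s).
Proof.
have phiE (c : nat -> K) : phi (\sum_(i < size s) c i *: s`_i) =
    \sum_(i < size s) scalar_map (c i) * (map phi s)`_i.
  by rewrite rmorph_sum; apply: eq_bigr => i _; rewrite scalar_mapE (nth_map 0).
rewrite indepP size_map; split=> [/lin_freeP|] h; last apply/lin_freeP => c E.
  by move=> c E; apply: h; apply: phi_inj; rewrite phiE rmorph0.
by apply: h; rewrite -phiE E rmorph0.
Qed.

Lemma submod_image_div W u : is_subspace W -> submod scalar_map (image_div W u).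
Proof.
move=> sW; split; first by exists 0; rewrite ?rmorph0 ?mul0r //; case: sW.
- move=> a b [e We Ee] [e' We' Ee']; exists (e + e'); first exact: subspaceD.
  by rewrite rmorphD mulrDl Ee Ee'.
- move=> c a [e We Ee]; exists (c *: e); first exact: subspaceZ.
  by rewrite scalar_mapE Ee mulrA.
Qed.

Lemma has_indep_image_div W u m : u != 0 ->
  has_indep scalar_map (image_div W u) m <-> free_in W m.
Proof.
move=> u0; split=> -[s [<- Ws fs]].
  have [|t Et Wt] := @map_preimage _ _ phi W [seq u * x | x <- s].
    by move=> _ /mapP[w /Ws[b Wb Eb] ->]; exists b; rewrite // Eb mulrC.
  exists t; split=> //; first by rewrite -(size_map phi) Et size_map.
  by apply/lin_free_indep; rewrite Et; exact: indep_mul.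
exists [seq u^-1 * x | x <- map phi s]; split; first by rewrite !size_map.
  move=> _ /mapP[_ /mapP[b /Ws Wb ->] ->].
  by exists b; rewrite // mulrC mulrA divff ?mul1r.
by apply: indep_mul; [rewrite invr_eq0|apply/lin_free_indep].
Qed.

End ScalarMap.

Lemma krull_dim_pos_not_scalar (K : fieldType) (A : comAlgType K) :
  krull_dim_pos A -> ~ forall a : A, exists c : K, a = c%:A.
Proof.
move=> [P [Q [[P0 _ _ _ _] [[_ _ QM Q1 _] [_ [x [Qx Px]]]]]]] /(_ x)[c Ex].
have [c0|c0] := eqVneq c 0; first by apply: Px; rewrite Ex c0 scale0r.
apply: Q1; have := QM c^-1%:A _ Qx.
by rewrite Ex mulr_algl scalerA mulVf // scale1r.
Qed.

Section Generation.
Context (K : fieldType) (A : comAlgType K).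
Implicit Types (Z : seq A) (a b : A).

Definition alg_span Z a : Prop := exists n, poly_le (in_alg A) Z n a.

Lemma alg_spanS Z Z' a : {subset Z <= Z'} -> alg_span Z a -> alg_span Z' a.
Proof. by move=> sub [n ha]; exists n; exact: poly_le_mono ha. Qed.

Lemma mem_alg_span Z a : a \in Z -> alg_span Z a.
Proof. by move=> aZ; exists 1%N; exact: poly_le_mem. Qed.

Lemma alg_spanD Z a b : alg_span Z a -> alg_span Z b -> alg_span Z (a + b).
Proof.
move=> [n ha] [m hb]; exists (maxn n m); apply: poly_le_add.
  by apply: poly_le_mono ha => //; exact: leq_maxl.
by apply: poly_le_mono hb => //; exact: leq_maxr.
Qed.

Lemma alg_spanM Z a b : alg_span Z a -> alg_span Z b -> alg_span Z (a * b).
Proof. by move=> [n ha] [m hb]; exists (n + m)%N; exact: poly_le_mul. Qed.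

Lemma in_alg_gen_span Z (P : A -> Prop) a :
  (forall x, P x -> alg_span Z x) -> in_alg_gen P a -> alg_span Z a.
Proof.
move=> hP [l [c [t [tP ->]]]].
elim/big_ind: _ => [||i _]; [by exists 0%N; exact: poly_le0|exact: alg_spanD|].
rewrite -mulr_algl; apply: alg_spanM; first by exists 0%N; exact: poly_le_const.
rewrite big_seq; elim/big_ind: _ => [||x /tP/hP//]; last exact: alg_spanM.
by exists 0%N; exact: poly_le1.
Qed.

Lemma in_alg_gen_finite (P : A -> Prop) a : in_alg_gen P a ->
  exists Z, (forall z, z \in Z -> P z) /\ alg_span Z a.
Proof.
move=> [l [c [t [tP Ea]]]]; exists (flatten [seq t i | i <- enum 'I_l]); split.
  by move=> z /flatten_mapP[i _]; exact: tP.
apply: (@in_alg_gen_span _ (fun x => x \in flatten [seq t i | i <- enum 'I_l])).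
  by move=> x; exact: mem_alg_span.
exists l, c, t; split=> // i x xt; apply/flatten_mapP; exists i => //.
by rewrite mem_enum.
Qed.

Lemma finite_generators (P : A -> Prop) : finite_type_alg A -> generated_by P ->
  exists Z, (forall z, z \in Z -> P z) /\ forall a, alg_span Z a.
Proof.
move=> [s hs] genP.
suff [Z [ZP sZ]] : exists Z,
    (forall z, z \in Z -> P z) /\ forall x, x \in s -> alg_span Z x.
  by exists Z; split=> // a; exact: in_alg_gen_span (hs a).
elim: (s) => [|x s' [Z [ZP sZ]]]; first by exists [::].
have [Z' [Z'P xZ']] := in_alg_gen_finite (genP x); exists (Z' ++ Z); split.
  by move=> z; rewrite mem_cat => /orP[/Z'P|/ZP].
move=> y; rewrite inE => /predU1P[->|/sZ].
  by apply: alg_spanS xZ' => z zZ'; rewrite mem_cat zZ'.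
by apply: alg_spanS => z zZ; rewrite mem_cat zZ orbT.
Qed.

Lemma nonzero_generator Z : (forall a, alg_span Z a) -> krull_dim_pos A ->
  exists2 z, z \in Z & z != 0.
Proof.
move=> genZ /krull_dim_pos_not_scalar nsc; apply: contrapT => no; apply: nsc => a.
have [n] := genZ a; elim=> {n a} [n c|n a b _ [c ->] _ [d ->]|n z a zZ _ _].
- by exists c.
- by exists (c + d); rewrite scalerDl.
- exists 0; rewrite scale0r; have [->|z0] := eqVneq z 0; first by rewrite mul0r.
  by case: no; exists z.
Qed.

Inductive homog Z : nat -> A -> Prop :=
| homog1 : homog Z 0 1
| homog0 n : homog Z n 0
| homogP n c a b : homog Z n a -> homog Z n b -> homog Z n (c *: a + b)
| homogM n z a : z \in Z -> homog Z n a -> homog Z n.+1 (z * a).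

Lemma homog_subspace Z n : is_subspace (homog Z n).
Proof. by split=> [|c u v]; [exact: homog0|exact: homogP]. Qed.

Lemma homogS_ind Z n (Y : A -> Prop) a : is_subspace Y ->
  (forall z b, z \in Z -> homog Z n b -> Y (z * b)) -> homog Z n.+1 a -> Y a.
Proof.
move=> [Y0 YZ] YM; move: {-1}n.+1 (erefl n.+1) => m Em h; move: Em.
elim: h => {m a} [//|//|m c a b _ IHa _ IHb Em|m z a zZ ha _ [Em]].
  by apply: YZ; [exact: IHa|exact: IHb].
by rewrite -Em in ha; exact: YM.
Qed.

Lemma poly_le_homog Z n a : poly_le (in_alg A) Z n a ->
  exists g : nat -> A, (forall i, homog Z i (g i)) /\ a = \sum_(i < n.+1) g i.
Proof.
elim=> {n a} [n c|n a b _ [g [hg ->]] _ [h [hh ->]]|n z a zZ _ [g [hg ->]]].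
- exists (fun i => if i is 0%N then c%:A else 0); split.
    by case=> [|i]; [apply: subspaceZ (homog_subspace Z 0) (homog1 Z)|exact: homog0].
  by rewrite big_ord_recl big1 ?addr0.
- exists (fun i => g i + h i); rewrite big_split; split=> // i.
  exact: subspaceD (homog_subspace Z i) _ _.
- exists (fun i => if i is j.+1 then z * g j else 0); split.
    by case=> [|i]; [exact: homog0|exact: homogM].
  by rewrite [RHS]big_ord_recl add0r mulr_sumr.
Qed.

Context (B : nat -> A -> Prop) (gB : graded_alg B).

Lemma graded_exp n m a : B n a -> B (m * n)%N (a ^+ m).
Proof.
case: gB => _ B1 BM _ _ Ba; elim: m => [//|m IH].
by rewrite exprS mulSn; exact: BM.
Qed.

Lemma graded_component (g : nat -> A) n N : (forall i, B i (g i)) -> (n < N)%N ->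
  B n (\sum_(i < N) g i) -> \sum_(i < N) g i = g n.
Proof.
case: gB => Bs _ _ _ Bdir Bg nN; set a := \sum_(i < N) g i => Ba.
pose c (i : 'I_N) := g i - (if i == Ordinal nN then a else 0).
have Bc (i : 'I_N) : B i (c i).
  apply: (subspaceD (Bs i)) => //; rewrite -scaleN1r; apply: (subspaceZ _ (Bs i)).
  by case: eqP => [->//|_]; case: (Bs i).
have := Bdir _ _ Bc _ (Ordinal nN); rewrite /c eqxx /= => /(_ _)/eqP.
rewrite subr_eq0 => an; apply/esym/eqP/an.
by rewrite sumrB -big_mkcond big_pred1_eq subrr.
Qed.

Context (Z : seq A) (ZB : forall z, z \in Z -> B 1%N z) (genZ : forall a, alg_span Z a).

Lemma homog_graded n a : homog Z n a -> B n a.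
Proof.
case: gB => Bs B1 BM _ _; elim=> {n a} [//|n|n c a1 a2 _ IH1 _ IH2|n z a1 zZ _ IH].
- by case: (Bs n).
- by case: (Bs n) => _; apply.
- by rewrite -add1n; apply: BM => //; exact: ZB.
Qed.

Lemma graded_homog n a : B n a -> homog Z n a.
Proof.
move=> Ba; have [m ha] := genZ a.
have [//||g [hg Ea]] := poly_le_homog (poly_le_mono (zs' := Z) (m := maxn n m) _ _ ha).
  exact: leq_maxr.
move: Ba; rewrite Ea => /(graded_component (fun i => homog_graded (hg i))) -> //.
by rewrite ltnS leq_maxl.
Qed.

Lemma graded_mul_ind (Y : A -> Prop) n m a : is_subspace Y ->
  (forall b b', B n b -> B m b' -> Y (b * b')) -> B (n + m)%N a -> Y a.
Proof.
case: (gB) => _ B1 BM _ _; elim: n Y a => [|n IH] Y a sY YM.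
  by move=> Ba; rewrite -[a]mul1r; exact: YM.
move=> /graded_homog; apply: homogS_ind => // z b zZ /homog_graded.
apply: (IH (fun b => Y (z * b))) => [|b1 b2 Bb1 Bb2]; first exact: subspace_mull.
by rewrite mulrA; apply: YM => //; rewrite -add1n; apply: BM => //; exact: ZB.
Qed.

End Generation.

Section GrowthOfGradedAlgebra.
Context (K : fieldType) (A : comAlgType K) (B : nat -> A -> Prop).
Implicit Types (E W Y : A -> Prop).

Definition mul_generated : Prop := forall Y n m, is_subspace Y ->
  (forall b b', B n b -> B m b' -> Y (b * b')) -> forall a, B (n + m)%N a -> Y a.

Definition dim_growth (d C : nat) : Prop := forall n (s : seq A),
  (forall x, x \in s -> B n x) -> lin_free s -> (size s <= C * n.+1 ^ d)%N.

(* [dim (E^N B_(dN+q)) >= N^d dim E], where [W] stands for any subspace that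
   contains the products. *)
Definition power_growth (d : nat) : Prop := forall N q m E W, (0 < N)%N ->
  is_subspace E -> is_subspace W -> free_in E m ->
  pow_mul_sub N E (B (d * N + q)%N) W -> free_in W (N ^ d * m).

Hypotheses (gB : graded_alg B) (intA : integral_alg A) (ftA : finite_type_alg A).
Hypotheses (genA : generated_by (B 1%N)) (krA : krull_dim_pos A).

Lemma graded_mul_generated : mul_generated.
Proof.
have [Z [ZB genZ]] := finite_generators ftA genA.
by move=> Y n m sY YM a; exact: (graded_mul_ind gB ZB genZ).
Qed.

Lemma mul_generated_pow Y p r k : mul_generated -> is_subspace Y ->
  pow_mul_sub k (B p) (B r) Y -> forall a, B (k * p + r)%N a -> Y a.
Proof.
move=> mulB; elim: k Y => [|k IH] Y sY hY a.
  by move=> Ba; have := hY _ Ba [::]; rewrite big_nil mul1r; apply.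
rewrite mulSn -addnA; apply: mulB => // b b' Bb.
apply: (IH (fun b' => Y (b * b'))); first exact: subspace_mull.
by move=> c /hY; exact: pow_colonS.
Qed.

Lemma nonzero_graded n : exists2 a, B n a & a != 0.
Proof.
have [Z [ZB genZ]] := finite_generators ftA genA.
have [x /ZB Bx x0] := nonzero_generator genZ krA.
exists (x ^+ n); first by rewrite -[n in B n]muln1; exact: graded_exp.
elim: n => [|n IH]; first by rewrite expr0; exact: intA.1.
by rewrite exprS; apply/eqP => /(intA.2)[] /eqP; apply/negP.
Qed.

Section Dehomogenization.
Context (Z : seq A) (x0 : A) (Fr : fieldType) (phi : {rmorphism A -> Fr}).
Hypotheses (ZB : forall z, z \in Z -> B 1%N z) (genZ : forall a, alg_span Z a).
Hypotheses (phi_inj : injective phi) (x0Z : x0 \in Z) (x0_neq0 : x0 != 0).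

Local Notation iota := (scalar_map phi).
Local Notation zs := [seq phi z / phi x0 | z <- Z].

Let phi_x0 : phi x0 != 0.
Proof. by rewrite -(rmorph0 phi) (inj_eq phi_inj). Qed.

Lemma dehomogenize n b : B n b -> poly_le iota zs n (phi b / phi x0 ^+ n).
Proof.
move=> /(graded_homog gB ZB genZ); elim=> {n b} [|n|n c a b _ IHa _ IHb|n z a zZ _ IH].
- by rewrite expr0 divr1 rmorph1; exact: poly_le1.
- by rewrite rmorph0 mul0r; exact: poly_le0.
- rewrite rmorphD scalar_mapE mulrDl -mulrA; apply: poly_le_add IHb.
  exact: poly_le_scale.
- rewrite rmorphM exprS invfM mulrACA; apply: poly_le_gen IH.
  by apply/mapP; exists z.
Qed.

Lemma homogenize_monom N xs w : {subset xs <= zs} -> monom_lt N xs w ->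
  image_div phi (B (size xs * N)%N) (phi x0 ^+ (size xs * N)) w.
Proof.
case: (gB) => _ B1 BM _ _; elim: xs w => [|x xs IH] w sub /=.
  by move=> ->; exists 1; rewrite // mul0n expr0 mulr1 rmorph1.
case=> b [w' [bN mw' ->]]; have [|y By Ey] := IH w' _ mw'.
  by move=> v hv; apply: sub; rewrite inE hv orbT.
have /mapP[z zZ Ex] := sub x (mem_head _ _).
have BX z' m : z' \in Z -> B m (z' ^+ m).
  by move=> /ZB Bz'; rewrite -[m in B m]muln1; exact: graded_exp.
exists (z ^+ b * x0 ^+ (N - b) * y).
  rewrite mulSn -{1}(subnKC (ltnW bN)).
  by apply: (BM) By; apply: BM; exact: BX.
have -> : phi x0 ^+ ((size xs).+1 * N) =
    phi x0 ^+ b * phi x0 ^+ (N - b) * phi x0 ^+ (size xs * N).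
  by rewrite -!exprD subnKC ?mulSn // ltnW.
rewrite !rmorphM !rmorphXn Ey (_ : phi z = x * phi x0) ?exprMn; first by ring.
by rewrite Ex divfK.
Qed.

Lemma growth_bound_dim d C : growth_bound iota zs d C -> dim_growth d C.
Proof.
move=> hC n s Bs /(lin_free_indep phi_inj) fs; have [g [t [g0 st ht]]] := hC n.
have g1 : g / phi x0 ^+ n != 0 by rewrite mulf_neq0 // invr_eq0 expf_neq0.
apply: leq_trans st; rewrite -(size_map phi) -(size_map ( *%R (g / phi x0 ^+ n))).
apply: (indep_size_le (indep_mul g1 fs)) => _ /mapP[_ /mapP[b /Bs Bb ->] ->].
exists 1; first exact: oner_neq0.
by rewrite rmorph1 mul1r mulrAC -mulrA; apply/ht/dehomogenize.
Qed.

Lemma alg_indep_power_growth xs : {subset xs <= zs} -> alg_indep xs iota ->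
  power_growth (size xs).
Proof.
move=> xs_zs xs_indep N q m E W N0 sE sW hE hEW.
have u0 : phi x0 ^+ (size xs * N + q) != 0 by rewrite expf_neq0.
apply/(has_indep_image_div phi_inj W _ u0).
apply: (indep_power_mul (V := image_div phi E 1) N0 xs_indep);
  try exact: submod_image_div.
  exact: (has_indep_image_div phi_inj E m (oner_neq0 Fr)).2 hE.
move=> w /(homogenize_monom xs_zs)[y By Ey] es ses hes.
have [e /hes[b Eb]|es' Ees' Ees] := @map_preimage _ _ phi E es.
  by rewrite mulr1 => <-; exists b.
exists ((\prod_(e <- es') e) * (y * x0 ^+ q)).
  apply: hEW => //; last by rewrite -ses -Ees' size_map.
  case: gB => _ _ BM _ _; apply: BM => //.
  by rewrite -[q in B q]muln1; apply: graded_exp => //; exact: ZB.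
by rewrite !rmorphM rmorphXn Ey -Ees' big_map rmorph_prod exprD; ring.
Qed.

End Dehomogenization.

Theorem graded_dim_growth : exists d C, dim_growth d C /\ power_growth d.
Proof.
have [Fr [phi phi_inj]] := integral_embedding intA.
have [Z [ZB genZ]] := finite_generators ftA genA.
have [x0 x0Z x0_neq0] := nonzero_generator genZ krA.
have [xs [C [xs_zs xs_indep hC]]] :=
  growth [seq phi z / phi x0 | z <- Z] (fmorph_inj (scalar_map phi)).
exists (size xs), C; split; first exact: growth_bound_dim hC.
exact: alg_indep_power_growth xs_zs xs_indep.
Qed.

End GrowthOfGradedAlgebra.

(** * Filtrations *)

Section Dimension.
Context (K : fieldType) (A : lmodType K).
Implicit Types (V W : A -> Prop) (s : seq A).

Definition fin_dim W : Prop := exists M, forall m, free_in W m -> (m <= M)%N.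

(* Zero if [W] is infinite dimensional. *)
Definition vdim W : nat := xget 0%N [set d | has_dim W d].

Lemma free_inS V W m : (forall a, V a -> W a) -> free_in V m -> free_in W m.
Proof. by move=> VW [s [sz Vs fs]]; exists s; split=> // x /Vs/VW. Qed.

Lemma fin_dimS V W : (forall a, V a -> W a) -> fin_dim W -> fin_dim V.
Proof. by move=> VW [M hM]; exists M => m /(free_inS VW)/hM. Qed.

Lemma free_in0 W : free_in W 0.
Proof. by exists [::]; split=> // c _ []. Qed.

Lemma free_in1 W a : W a -> a != 0 -> free_in W 1.
Proof.
move=> Wa a0; exists [:: a]; split=> // [x|c]; first by rewrite inE => /eqP ->.
rewrite big_ord1 /= => /eqP; rewrite scaler_eq0 (negPf a0) orbF => /eqP c0 i.
by rewrite ord1.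
Qed.

Lemma lin_free_cons W s a : is_subspace W -> (forall x, x \in s -> W x) ->
  lin_free s -> ~ W a -> lin_free (a :: s).
Proof.
move=> sW Ws fs Wa c; rewrite big_ord_recl /= => E.
have Wsum : W (\sum_(i < size s) c (lift ord0 i) *: s`_i).
  by apply: (subspace_sum _ sW) => i _; apply/(subspaceZ _ sW)/Ws/mem_nth.
have c0 : c ord0 = 0.
  apply/eqP; apply: contrapT => /negP c0; apply: Wa.
  have -> : a = - (c ord0)^-1 *: \sum_(i < size s) c (lift ord0 i) *: s`_i.
    move/eqP: E; rewrite addr_eq0 => /eqP E.
    by rewrite scaleNr -scalerN -E scalerA mulVf // scale1r.
  exact: subspaceZ.
move: E; rewrite c0 scale0r add0r => /(fs (c \o lift ord0)) E i.
by case: (unliftP ord0 i) => [j|] -> //; exact: E.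
Qed.

Lemma has_dim_vdim W : fin_dim W -> has_dim W (vdim W).
Proof.
move=> [M hM]; apply: (xgetPex 0%N).
have ex : exists n, `[< free_in W n >] by exists 0%N; apply/asboolP; exact: free_in0.
have bd n : `[< free_in W n >] -> (n <= M)%N by move=> /asboolP/hM.
case: (ex_maxnP ex bd) => d /asboolP[s [sz Ws fs]] hd; exists d; split.
  by exists s.
by move=> t Wt ft; apply: hd; apply/asboolP; exists t.
Qed.

Lemma free_in_vdim W : fin_dim W -> free_in W (vdim W).
Proof. by case/has_dim_vdim => -[s [sz [Ws fs]]] _; exists s. Qed.

Lemma free_in_le_vdim W m : fin_dim W -> free_in W m -> (m <= vdim W)%N.
Proof. by case/has_dim_vdim => _ h [s [<- Ws fs]]; exact: h. Qed.

Lemma vdimS V W : (forall a, V a -> W a) -> fin_dim W -> (vdim V <= vdim W)%N.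
Proof.
move=> VW fW; apply/(free_in_le_vdim fW)/(free_inS VW).
exact/free_in_vdim/(fin_dimS VW).
Qed.

Lemma eq_vdim V W : (forall a, V a <-> W a) -> fin_dim W -> vdim V = vdim W.
Proof.
move=> VW fW; have VW1 a := (VW a).1; have VW2 a := (VW a).2.
by apply/eqP; rewrite eqn_leq (vdimS VW1) //= (vdimS VW2) //; exact: fin_dimS fW.
Qed.

Lemma vdim_le_sub V W : is_subspace V -> (forall a, V a -> W a) -> fin_dim W ->
  (vdim W <= vdim V)%N -> forall a, W a -> V a.
Proof.
move=> sV VW fW WV a Wa; apply: contrapT => Va; move: WV; rewrite leqNgt => /negP[].
have [s [<- Vs fs]] := free_in_vdim (fin_dimS VW fW).
apply: (free_in_le_vdim fW); exists (a :: s); split=> //.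
  by move=> x; rewrite inE => /predU1P[->//|/Vs/VW].
exact: lin_free_cons Va.
Qed.

Lemma vdim_gt0 W a : fin_dim W -> W a -> a != 0 -> (0 < vdim W)%N.
Proof. by move=> fW Wa a0; apply: (free_in_le_vdim fW); exact: free_in1 Wa a0. Qed.

Lemma vdim_eq0 W : fin_dim W -> (forall a, W a -> a = 0) -> vdim W = 0%N.
Proof.
move=> fW W0; have [s [<- Ws fs]] := free_in_vdim fW.
case: s Ws fs => [//|x s] Ws fs.
have := (lin_freeP _).1 fs (fun i => (i == 0%N)%:R) _ 0%N isT.
rewrite big_ord_recl /= [x]W0 ?scaler0 ?add0r; last by apply: Ws; exact: mem_head.
rewrite big1 => [/(_ erefl)/eqP|i _]; first by rewrite oner_eq0.
by rewrite scale0r.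
Qed.

End Dimension.

Section GoodFiltration.
Context (R : realType) (K : fieldType) (A : lmodType K).
Context (W : A -> Prop) (F : R -> A -> Prop).
Hypotheses (goodF : good_filtration W F) (fW : fin_dim W).

Lemma filtration_subspace s : is_subspace (F s).
Proof. by case: goodF => h _ _ _ _; case: (h s). Qed.

Lemma filtration_sub s a : F s a -> W a.
Proof. by case: goodF => h _ _ _ _; case: (h s) => _; apply. Qed.

Lemma filtration_le s t a : s <= t -> F t a -> F s a.
Proof. by case: goodF => _ h _ _ _; exact: h. Qed.

Lemma filtration_fin_dim s : fin_dim (F s).
Proof. by apply: fin_dimS fW => a; exact: filtration_sub. Qed.

Lemma filtration_full : exists s, forall a, W a -> F s a.
Proof.
have [s max_s] : exists s, forall t, (vdim (F t) <= vdim (F s))%N.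
  by apply: exists_argmax 0 _ _ => t; apply: vdimS fW => a; exact: filtration_sub.
exists s => a Wa; have [t Fa] : exists t, F t a by case: goodF => _ _ _ h _; exact: h.
have [st|/ltW ts] := leP s t; first exact: filtration_le Fa.
apply: vdim_le_sub (max_s t) _ Fa; first exact: filtration_subspace.
  by move=> b; exact: filtration_le.
exact: filtration_fin_dim.
Qed.

Lemma filtration_trivial : exists s, forall a, F s a -> a = 0.
Proof.
have [s min_s] := exists_argmin (fun s => vdim (F s)) 0.
exists s => a Fa; case: goodF => _ _ + _ _; apply => t.
have [ts|/ltW st] := leP t s; first exact: filtration_le Fa.
apply: vdim_le_sub (min_s t) _ Fa; first exact: filtration_subspace.
  by move=> b; exact: filtration_le.
exact: filtration_fin_dim.
Qed.

End GoodFiltration.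

Lemma exists_uniform_lower (R : realDomainType) (P : nat -> R -> Prop) :
  (forall n s t, s <= t -> P n t -> P n s) -> (forall n, exists s, P n s) ->
  forall N, exists s, forall n, (n < N)%N -> P n s.
Proof.
move=> Ple Pex; elim=> [|N [s hs]]; first by exists 0.
have [t ht] := Pex N; exists (Num.min s t) => n; rewrite ltnS leq_eqVlt.
move=> /predU1P[->|/hs h]; first by apply: Ple ht; rewrite ge_min lexx orbT.
by apply: Ple h; rewrite ge_min lexx.
Qed.

Lemma exists_uniform_lower_near (R : realDomainType) (P : nat -> R -> Prop) s0 :
  (forall n s t, s <= t -> P n t -> P n s) -> (forall n, exists s, P n s) ->
  (\forall n \near \oo, P n s0) -> exists s, forall n, P n s.
Proof.
move=> Ple Pex [N _ hN]; have [s hs] := exists_uniform_lower Ple Pex N.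
exists (Num.min s s0) => n; have [nN|Nn] := ltnP n N.
  by apply: Ple (hs n nN); rewrite ge_min lexx.
by apply: Ple (hN n Nn); rewrite ge_min lexx orbT.
Qed.

Section ErrorTerms.
Context (R : realType) (f : nat -> R).
Hypotheses (f_ge0 : forall n, 0 <= f n) (f_mono : forall n m, (n <= m)%N -> f n <= f m).
Hypothesis f_cvg : cvgn (series (fun a : nat => f (2 ^ a)%N / (2 ^ a)%:R)).

Local Notation u := (fun a : nat => f (2 ^ a)%N / (2 ^ a)%:R).

Lemma dyadic_tail (e : R) : 0 < e ->
  \forall b \near \oo, forall a, \sum_(i < a) u (b + i)%N <= e.
Proof.
move=> e0; have u0 a : 0 <= u a by rewrite divr_ge0.
have nd : nondecreasing_seq (series u).
  by apply/nondecreasing_seqP => n; rewrite seriesSr lerDl.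
have le_lim b : series u b <= limn (series u) by exact: nondecreasing_cvgn_le.
have /cvgrPdist_le/(_ _ e0) := f_cvg; apply: filterS => b + a.
rewrite ger0_norm ?subr_ge0 //; apply: le_trans.
have -> : \sum_(i < a) u (b + i)%N = series u (b + a)%N - series u b.
  elim: a => [|a IH]; first by rewrite big_ord0 addn0 subrr.
  by rewrite big_ord_recr /= IH addnS seriesSr addrAC.
by rewrite lerD2r.
Qed.

Lemma dyadic_bracket (p : nat) : (0 < p)%N -> exists b, (p <= 2 ^ b <= 2 * p)%N.
Proof.
move=> p0; exists (trunc_log 2 p).+1; apply/andP; split; first exact/ltnW/trunc_log_ltn.
by rewrite expnS leq_mul2l /= trunc_logP.
Qed.

Lemma f_pow b : f (2 ^ b)%N = u b * (2 ^ b)%:R.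
Proof. by rewrite divfK // pnatr_eq0 expn_eq0. Qed.

Lemma f_small (e : R) : 0 < e -> \forall n \near \oo, f n <= e * n%:R.
Proof.
move=> e0; have [|b0 _ hb0] := @dyadic_tail (e / 2); first by rewrite divr_gt0.
exists (2 ^ b0)%N => // n /= hn.
have n0 : (0 < n)%N by apply: leq_trans hn; rewrite expn_gt0.
have [b /andP[nb bn]] := dyadic_bracket n0.
have b0b : (b0 <= b)%N by rewrite -(@leq_exp2l 2) //; exact: leq_trans nb.
have := hb0 b b0b 1%N; rewrite big_ord1 /= addn0 => hu.
apply: le_trans (f_mono nb) _; rewrite f_pow.
apply: le_trans (ler_wpM2r _ hu) _ => //.
by rewrite -mulrA ler_pM2l // ler_pdivrMl // -natrM ler_nat.
Qed.

(* The error made in multiplying at most [2 ^ a] elements of degree [p] by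
   successive halving. *)
Fixpoint prod_err (p a : nat) : R :=
  if a is a'.+1 then 2 * prod_err p a' + 2 * f (2 ^ a' * p)%N else 0.

Lemma prod_err_ge0 p a : 0 <= prod_err p a.
Proof. by elim: a => //= a IH; rewrite addr_ge0 ?mulr_ge0. Qed.

Lemma prod_err_le p b a : (p <= 2 ^ b)%N ->
  prod_err p a <= (2 ^ a)%:R * (2 ^ b)%:R * \sum_(i < a) u (b + i)%N.
Proof.
move=> pb; elim: a => [|a IH]; first by rewrite big_ord0 mulr0.
have fb : f (2 ^ a * p)%N <= u (b + a)%N * ((2 ^ b)%:R * (2 ^ a)%:R).
  by rewrite -natrM -expnD -f_pow f_mono // addnC expnD leq_mul2l pb orbT.
rewrite big_ord_recr /= expnS natrM mulrDr lerD //.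
  by rewrite -!mulrA ler_wpM2l // !mulrA.
have -> : 2 * (2 ^ a)%:R * (2 ^ b)%:R * u (b + a)%N =
    2 * (u (b + a)%N * ((2 ^ b)%:R * (2 ^ a)%:R)) by ring.
by rewrite ler_wpM2l.
Qed.

Lemma prod_err_small (e : R) : 0 < e ->
  \forall p \near \oo, forall a, prod_err p a <= (2 ^ a)%:R * p%:R * e.
Proof.
move=> e0; have [|b0 _ hb0] := @dyadic_tail (e / 2); first by rewrite divr_gt0.
exists (2 ^ b0)%N => // p /= hp a.
have p0 : (0 < p)%N by apply: leq_trans hp; rewrite expn_gt0.
have [b /andP[pb bp]] := dyadic_bracket p0.
have b0b : (b0 <= b)%N by rewrite -(@leq_exp2l 2) //; exact: leq_trans pb.
apply: le_trans (prod_err_le a pb) _; rewrite -!mulrA ler_wpM2l //.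
apply: le_trans (ler_wpM2l _ (hb0 b b0b a)) _ => //.
by rewrite mulrCA [leRHS]mulrC ler_pM2l // ler_pdivrMr // -natrM ler_nat mulnC.
Qed.

End ErrorTerms.

Lemma nat_split n q0 p r : (0 < p)%N -> (q0 + p + r <= n)%N ->
  exists k q, [/\ (1 <= k)%N, n = (k * p + (r * k + q))%N,
    (q0 <= r * k + q)%N & (q <= q0 + p + r)%N].
Proof.
move=> p0 nq; have pr0 : (0 < p + r)%N by lia.
pose k := ((n - q0) %/ (p + r))%N; exists k, (n - k * (p + r))%N.
have k1 : (1 <= k)%N by rewrite divn_gt0 //; lia.
have Ek := divn_eq (n - q0) (p + r); rewrite -/k in Ek.
have hmod : ((n - q0) %% (p + r) < p + r)%N by rewrite ltn_mod.
by split=> //; nia.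
Qed.

Lemma nat_split_near (R : realType) q0 r (e : R) : 0 < e ->
  \forall p \near \oo, \forall n \near \oo, exists k q,
    [/\ (1 <= k)%N, n = (k * p + (r * k + q))%N, (q0 <= r * k + q)%N &
        (r * k + q)%:R <= e * n%:R].
Proof.
move=> e0; apply: filterS2 (nbhs_infty_ge 1) (nbhs_infty_ger (2 * r%:R / e)) => p p1.
rewrite ler_pdivrMr // => rp.
apply: filterS2 (nbhs_infty_ge (q0 + p + r)) (nbhs_infty_ger (2 * (q0 + p + r)%:R / e)).
move=> n nq; rewrite ler_pdivrMr // => qn.
have [k [q [k1 En q0q qle]]] := nat_split p1 nq; exists k, q; split=> //.
have kpn : k%:R * p%:R <= n%:R :> R by rewrite -natrM ler_nat En leq_addr.
have qR : q%:R <= (q0 + p + r)%:R :> R by rewrite ler_nat.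
have rk : 2 * r%:R * k%:R <= p%:R * e * k%:R by rewrite ler_wpM2r.
have kpe : k%:R * p%:R * e <= n%:R * e by rewrite ler_wpM2r // ltW.
by rewrite natrD natrM; lra.
Qed.

Section PseudoFiltered.
Context (R : realType) (K : fieldType) (A : comAlgType K).
Context (f : nat -> R) (B : nat -> A -> Prop) (F : nat -> R -> A -> Prop).
Hypotheses (f_ge0 : forall n, 0 <= f n) (f_mono : forall n m, (n <= m)%N -> f n <= f m).
Hypothesis f_cvg : cvgn (series (fun a : nat => f (2 ^ a)%N / (2 ^ a)%:R)).
Hypothesis filtF : forall n, (1 <= n)%N -> good_filtration (B n) (F n).
Context (N0 : nat).
Hypothesis mulF : forall n m : nat, (N0 <= n)%N -> (N0 <= m)%N ->
  forall (s t : R) (a b : A), F n s a -> F m t b ->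
    F (n + m)%N (s + t - f n - f m) (a * b).

Lemma graded_filtration_le n s t a : (1 <= n)%N -> s <= t -> F n t a -> F n s a.
Proof. by move=> n1; exact: (filtration_le (filtF n1)). Qed.

Lemma prod_filtration p s a (es : seq A) : (1 <= p)%N -> (N0 <= p)%N ->
  (0 < size es <= 2 ^ a)%N -> (forall e, e \in es -> F p s e) ->
  F (size es * p)%N ((size es)%:R * s - prod_err f p a) (\prod_(e <- es) e).
Proof.
move=> p1 pN; elim: a es => [|a IH] es /andP[es0 esa] hes.
  case: es es0 esa hes => [//|e [|//]] _ _ hes.
  by rewrite big_seq1 mul1n mul1r subr0; apply: hes; exact: mem_head.
have [es1|es2] := leqP (size es) 1.
  case: es es0 esa hes es1 => [//|e [|//]] _ _ hes _.
  rewrite big_seq1 mul1n mul1r; apply: (graded_filtration_le (t := s)) => //.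
    by rewrite gerBl; exact: prod_err_ge0.
  by apply: hes; exact: mem_head.
pose l := take (size es %/ 2) es; pose r := drop (size es %/ 2) es.
have Es : size es = (size l + size r)%N by rewrite -size_cat cat_take_drop.
have sl : size l = (size es %/ 2)%N by rewrite size_takel // leq_div.
rewrite expnS in esa.
have Fl : F (size l * p)%N ((size l)%:R * s - prod_err f p a) (\prod_(e <- l) e).
  by apply: IH => [|e /mem_take/hes //]; lia.
have Fr : F (size r * p)%N ((size r)%:R * s - prod_err f p a) (\prod_(e <- r) e).
  by apply: IH => [|e /mem_drop/hes //]; lia.
have f_le m : (m <= 2 ^ a)%N -> f (m * p)%N <= f (2 ^ a * p)%N.
  by move=> ma; rewrite f_mono // leq_mul2r ma orbT.
have fl := f_le (size l) (ltac:(lia)); have fr := f_le (size r) (ltac:(lia)).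
have N0_mul m : (0 < m)%N -> (N0 <= m * p)%N by move=> /(leq_pmull p); exact: leq_trans.
have := mulF (N0_mul (size l) ltac:(lia)) (N0_mul (size r) ltac:(lia)) Fl Fr.
rewrite -big_cat cat_take_drop -mulnDl -Es; apply: graded_filtration_le.
  by rewrite muln_gt0 es0.
have -> : (size es)%:R = (size l)%:R + (size r)%:R :> R by rewrite -natrD -Es.
by rewrite /=; lra.
Qed.

Lemma prod_filtration_near (e : R) : 0 < e ->
  \forall p \near \oo, forall s (es : seq A), (0 < size es)%N ->
    (forall x, x \in es -> F p s x) ->
    F (size es * p)%N ((size es)%:R * (s - p%:R * e)) (\prod_(x <- es) x).
Proof.
move=> e0; have e2 : 0 < e / 2 by rewrite divr_gt0.
apply: filterS2 (prod_err_small f_ge0 f_mono f_cvg e2) (nbhs_infty_ge (maxn 1 N0)) => p.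
rewrite geq_max => err_p /andP[p1 pN] s es es0 hes.
have [b /andP[esb bes]] := dyadic_bracket es0.
apply: graded_filtration_le (prod_filtration (a := b) p1 pN _ hes); last by rewrite es0.
  by rewrite muln_gt0 es0.
rewrite mulrBr lerD2l lerN2; apply: le_trans (err_p b) _.
have : (2 ^ b)%:R * (p%:R * (e / 2)) <= (2 * size es)%:R * (p%:R * (e / 2)).
  by rewrite ler_wpM2r ?ler_nat // mulr_ge0 // ltW.
by rewrite natrM; lra.
Qed.

Context (d C : nat).
Hypotheses (dimB : dim_growth B d C) (mulB : mul_generated B) (powB : power_growth B d).

Lemma fin_dim_graded n : fin_dim (B n).
Proof. by exists (C * n.+1 ^ d)%N => m [s [<- Bs fs]]; exact: dimB Bs fs. Qed.

Lemma filtration_lower_lt N : exists2 s : R, s <= 0 &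
  forall r a, (1 <= r < N)%N -> B r a -> F r s a.
Proof.
have [||s hs] := @exists_uniform_lower R
    (fun r s => (1 <= r)%N -> forall a, B r a -> F r s a) _ _ N.
- by move=> n s t st ht n1 a /(ht n1); exact: graded_filtration_le.
- move=> n; have [n1|_] := leqP 1 n; last by exists 0.
  by have [s hs] := filtration_full (filtF n1) (fin_dim_graded n); exists s.
exists (Num.min 0 s) => [|r a /andP[r1 rN] /(hs r rN r1)]; first by rewrite ge_min lexx.
by apply: graded_filtration_le => //; rewrite ge_min lexx orbT.
Qed.

Lemma filtration_lower : exists c : R, 0 <= c /\
  \forall n \near \oo, forall a, B n a -> F n (- c * n%:R) a.
Proof.
have [P0 _ hP0] := prod_filtration_near ltr01; pose P := maxn P0 (maxn 1 N0).
have [P1 PN PP0] : [/\ (1 <= P)%N, (N0 <= P)%N & (P0 <= P)%N].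
  by rewrite /P; split; lia.
have [s s_le0 hs] := filtration_lower_lt (P + P).+1.
exists (3 - 2 * s); split; first lra.
apply: filterS2 (nbhs_infty_ge (P + P)) (f_small f_ge0 f_mono f_cvg ltr01) => n nP f_n a.
have [|k [q [k1 En Pq qP]]] := @nat_split n P P 0 P1; first by rewrite addn0.
rewrite mul0n add0n addn0 in En Pq qP.
have n1 : (1 <= n)%N by lia.
rewrite {1}En; apply: (mul_generated_pow mulB).
  exact: (filtration_subspace (filtF n1)).
move=> b Bb es ses Bes.
have Fes : F (k * P)%N (k%:R * (s - P%:R * 1)) (\prod_(e <- es) e).
  rewrite -ses; apply: hP0 => //; first by rewrite ses.
  by move=> x /Bes; apply: hs; lia.
have Fb : F q s b by apply: hs Bb; lia.
have := mulF (_ : N0 <= k * P)%N (_ : N0 <= q)%N Fes Fb.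
rewrite -En => /(_ ltac:(nia) ltac:(lia)); apply: graded_filtration_le => //.
have f_kP : f (k * P)%N <= 1 * n%:R by apply: le_trans f_n; apply: f_mono; lia.
have f_q : f q <= 1 * n%:R by apply: le_trans f_n; apply: f_mono; lia.
have kn : k%:R <= n%:R :> R by rewrite ler_nat; nia.
have kPn : k%:R * P%:R <= n%:R :> R by rewrite -natrM ler_nat; lia.
have n1R : 1 <= n%:R :> R by rewrite ler1n.
nra.
Qed.

(* The loss [n e] absorbs the error of the product of [k] factors, the remainder
   [d k + q], which is [o(n)], and the two values of [f]. *)
Lemma pow_mul_filtration (t e del : R) : 0 < e -> 0 < del ->
  \forall p \near \oo, \forall n \near \oo, exists k q,
    [/\ (1 <= k)%N, (1 - del) * n%:R <= k%:R * p%:R &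
        pow_mul_sub k (F p (p%:R * t)) (B (d * k + q)%N) (F n (n%:R * (t - e)))].
Proof.
move=> e0 del0; have [c [c0 [nl _ lowF]]] := filtration_lower.
have [e4 e8] : 0 < e / 4 /\ 0 < e / 8 by split; rewrite divr_gt0.
pose a := c + `|t| + 1; have a0 : 0 < a by rewrite ltr_pwDr // addr_ge0.
have e'0 : 0 < Num.min del (e / 4 / a) by rewrite lt_min del0 divr_gt0.
apply: filterS3 (nbhs_infty_ge (maxn 1 N0)) (prod_filtration_near e4)
  (nat_split_near (maxn nl (maxn 1 N0)) d e'0) => p.
rewrite geq_max => /andP[p1 pN] prod_p.
apply: filterS2 (f_small f_ge0 f_mono f_cvg e8) => n f_n [k [q [k1 En]]].
rewrite !geq_max => /and3P[nlX X1 XN] Xn; exists k, q.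
have kpN : (N0 <= k * p)%N by exact: leq_trans pN (leq_pmull p k1).
have kp_n : (k * p <= n)%N by rewrite En leq_addr.
have X_n : (d * k + q <= n)%N by rewrite En leq_addl.
have n1 : (1 <= n)%N by exact: leq_trans X_n.
have EnR : n%:R = k%:R * p%:R + (d * k + q)%:R :> R by rewrite -natrM -natrD -En.
set X := (d * k + q)%N in En nlX X1 XN Xn X_n EnR *.
have en0 : 0 <= e * n%:R by rewrite mulr_ge0 // ltW.
have Xdel : X%:R <= del * n%:R by apply: le_trans Xn _; rewrite ler_wpM2r // ge_min lexx.
have Xa : X%:R * a <= e / 4 * n%:R.
  rewrite -ler_pdivlMr // mulrAC; apply: le_trans Xn _.
  by rewrite ler_wpM2r // ge_min lexx orbT.
split=> // [|y By es ses hes]; first lra.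
have Fes : F (k * p)%N (k%:R * (p%:R * t - p%:R * (e / 4))) (\prod_(x <- es) x).
  by rewrite -ses; apply: prod_p; rewrite ?ses.
have := mulF kpN XN Fes (lowF X nlX y By); rewrite -En.
apply: graded_filtration_le => //.
have f_kp : f (k * p)%N <= e / 8 * n%:R by exact: le_trans (f_mono kp_n) f_n.
have f_X : f X <= e / 8 * n%:R by exact: le_trans (f_mono X_n) f_n.
have Xt : X%:R * (t + c) <= X%:R * a.
  by rewrite ler_wpM2l // /a; have := ler_norm t; lra.
have kpe : k%:R * p%:R * (e / 4) <= n%:R * (e / 4).
  by apply: ler_wpM2r; [exact: ltW|rewrite EnR lerDl].
by rewrite EnR in f_kp f_X Xa kpe en0 *; lra.
Qed.

Lemma vdim_compare (t e del : R) : 0 < e -> 0 < del ->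
  \forall p \near \oo, \forall n \near \oo, exists k,
    [/\ (1 <= k)%N, (1 - del) * n%:R <= k%:R * p%:R &
      (k ^ d * vdim (F p (p%:R * t)) <= vdim (F n (n%:R * (t - e))))%N].
Proof.
move=> e0 del0.
apply: filterS2 (nbhs_infty_ge 1) (pow_mul_filtration t e0 del0) => p p1.
apply: filterS2 (nbhs_infty_ge 1) => n n1 [k [q [k1 kp kF]]]; exists k; split=> //.
apply: free_in_le_vdim; first exact: filtration_fin_dim (filtF n1) (fin_dim_graded n) _.
apply: (powB k1 _ _ _ kF); first exact: (filtration_subspace (filtF p1)).
  exact: (filtration_subspace (filtF n1)).
exact/free_in_vdim/(filtration_fin_dim (filtF p1) (fin_dim_graded p)).
Qed.

End PseudoFiltered.
(** * Asymptotic dimensions *)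

Section LimsupLiminf.
Context (R : realType).
Implicit Types (u v w : nat -> R).

Definition limsup_le_liminf u v : Prop := forall eta, 0 < eta ->
  \forall p \near \oo, \forall n \near \oo, u p <= v n + eta.

Lemma eq_limsup_le_liminf u u' v v' :
  (\forall n \near \oo, u n = u' n) -> (\forall n \near \oo, v n = v' n) ->
  limsup_le_liminf u v -> limsup_le_liminf u' v'.
Proof.
move=> uu' vv' uv eta /uv; apply: filterS2 uu' => p <-.
by apply: filterS2 vv' => n <-.
Qed.

Lemma limsup_le_liminf_cvgn u M :
  (forall n, `|u n| <= M) -> limsup_le_liminf u u -> cvgn u.
Proof.
move=> uM uu; pose S := [set y : R | \forall n \near \oo, y <= u n].
have supS : has_sup S.
  split.
    by exists (- M); apply: nearW => n; move: (uM n); rewrite ler_norml => /andP[].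
  exists M => y [N _ hN]; apply: le_trans (hN N (leqnn N)) _.
  exact: le_trans (ler_norm _) (uM N).
apply/cvg_ex; exists (sup S); apply/cvgrPdist_le => eta eta0.
have [y Sy /ltW yS] := sup_adherent eta0 supS.
apply: filterS2 Sy (uu _ eta0) => n yn uun; rewrite ler_distl.
have Sn : S (u n - eta) by apply: filterS uun => m; rewrite lerBlDr.
by have uS := sup_upper_bound supS Sn; apply/andP; split; lra.
Qed.

Lemma limsup_le_liminf_div u v w L : limsup_le_liminf u v ->
  w @ \oo --> L -> 0 < L -> (\forall n \near \oo, 0 <= v n <= w n) ->
  limsup_le_liminf (fun n => u n / w n) (fun n => v n / w n).
Proof.
move=> uv wL L0 vw eta eta0; pose e := eta * L / 6.
have e0 : 0 < e by rewrite divr_gt0 // mulr_gt0.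
have L2 : 0 < L / 2 by rewrite divr_gt0.
move/cvgrPdist_le in wL.
have wnear : \forall n \near \oo, `|L - w n| <= e /\ L / 2 <= w n.
  apply: filterS2 (wL _ e0) (wL _ L2) => n wLe.
  by rewrite ler_distl => /andP[_ Lw]; split=> //; lra.
apply: filterS2 (wnear) (uv _ e0) => p [wpe wp2]; apply: filterS3 wnear vw.
move=> n [wne wn2] /andP[v0 vwn] uvn.
have wp0 : 0 < w p by lra.
have wn0 : 0 < w n by lra.
rewrite ler_pdivrMr // mulrDl.
set Q := v n / w n; have Q0 : 0 <= Q by rewrite divr_ge0 // ltW.
have Q1 : Q <= 1 by rewrite ler_pdivrMr // mul1r.
have vQ : v n = Q * w n by rewrite divfK ?gt_eqF.
have : Q * (w n - w p) <= 1 * (2 * e).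
  apply: (@le_trans _ _ (Q * (2 * e))); last by rewrite ler_wpM2r // mulr_ge0 // ltW.
  rewrite ler_wpM2l //; move: wpe wne.
  by rewrite !ler_distl => /andP[? ?] /andP[? ?]; lra.
have : eta * (L / 2) <= eta * w p by rewrite ler_wpM2l // ltW.
by rewrite /e in uvn *; lra.
Qed.

End LimsupLiminf.

Lemma bernoulli_sub (R : realFieldType) (x : R) d : 0 <= x <= 1 ->
  1 - d%:R * x <= (1 - x) ^+ d.
Proof.
move=> /andP[x0 x1]; elim: d => [|d IH]; first by rewrite mul0r subr0 expr0.
rewrite exprS; have h := ler_wpM2l (ltac:(lra) : 0 <= 1 - x) IH.
apply: le_trans h; rewrite -natr1.
have : 0 <= d%:R * (x * x) :> R by rewrite !mulr_ge0.
lra.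
Qed.

Section DimensionRatios.
Context (R : realType) (K : fieldType) (A : comAlgType K).
Context (B : nat -> A -> Prop) (F : nat -> R -> A -> Prop) (d C : nat).
Hypothesis filtF : forall n, (1 <= n)%N -> good_filtration (B n) (F n).
Hypothesis dimB : dim_growth B d C.
Hypothesis B_neq0 : forall n, exists2 a, B n a & a != 0.
Context (c : R).
Hypothesis lowF : \forall n \near \oo, forall a, B n a -> F n (- c * n%:R) a.
Hypothesis vdim_cmp : forall t e del : R, 0 < e -> 0 < del ->
  \forall p \near \oo, \forall n \near \oo, exists k,
    [/\ (1 <= k)%N, (1 - del) * n%:R <= k%:R * p%:R &
      (k ^ d * vdim (F p (p%:R * t)) <= vdim (F n (n%:R * (t - e))))%N].

Definition tail_ratio (t : R) (n : nat) : R :=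
  (vdim (F n (n%:R * t)))%:R / (vdim (B n))%:R.

Let fin_B n : fin_dim (B n) := fin_dim_graded dimB n.

Lemma vdim_filtration_le n s : (1 <= n)%N -> (vdim (F n s) <= vdim (B n))%N.
Proof.
by move=> n1; apply: vdimS (fin_B n) => a; exact: (filtration_sub (filtF n1)).
Qed.

Lemma vdim_graded_gt0 n : (0 < vdim (B n))%N.
Proof. by have [a Ba a0] := B_neq0 n; exact: vdim_gt0 (fin_B n) Ba a0. Qed.

(* Normalization by [(n + 1) ^ d] avoids a division by zero at [n = 0]. *)
Let U n : R := (vdim (B n))%:R / n.+1%:R ^+ d.
Let H t n : R := (vdim (F n (n%:R * t)))%:R / n.+1%:R ^+ d.

Let pow_gt0 n : 0 < n.+1%:R ^+ d :> R.
Proof. by rewrite exprn_gt0. Qed.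

Let H_ge0 t n : 0 <= H t n.
Proof. by rewrite divr_ge0 // ltW. Qed.

Let H_le_U t n : (1 <= n)%N -> H t n <= U n.
Proof. by move=> n1; rewrite ler_pM2r ?invr_gt0 // ler_nat vdim_filtration_le. Qed.

Let U_le_C n : U n <= C%:R.
Proof.
rewrite ler_pdivrMr // -natrX -natrM ler_nat.
by have [s [<- Bs fs]] := free_in_vdim (fin_B n); exact: dimB Bs fs.
Qed.

Let H_lowE : \forall n \near \oo, H (- c) n = U n.
Proof.
apply: filterS2 (nbhs_infty_ge 1) lowF => n n1 Bn; congr (_%:R / _).
apply: (eq_vdim _ (fin_B n)) => a; split; first exact: (filtration_sub (filtF n1)).
by move=> /Bn; rewrite mulrC.
Qed.

Let H_compare_mul t e del : 0 < e -> 0 < del <= 1 ->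
  \forall p \near \oo, \forall n \near \oo, (1 - d%:R * del) * H t p <= H (t - e) n.
Proof.
move=> e0 /andP[del0 del1]; apply: filterS (vdim_cmp t e0 del0) => p.
apply: filterS => n [k [k1 kp kF]].
have kpS : (1 - del) * n.+1%:R <= k%:R * p.+1%:R.
  have k1R : 1 <= k%:R :> R by rewrite ler1n.
  by rewrite -!natr1; lra.
apply: (@le_trans _ _ ((1 - del) ^+ d * H t p)).
  by rewrite ler_wpM2r // bernoulli_sub // ltW.
rewrite ler_pdivlMr // mulrAC -exprMn.
apply: (@le_trans _ _ ((k%:R * p.+1%:R) ^+ d * H t p)).
  by rewrite ler_wpM2r // lerXn2r // nnegrE mulr_ge0 // subr_ge0 //.
rewrite exprMn -mulrA [_ ^+ d * (_ / _)]mulrC divfK ?gt_eqF //.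
by rewrite -natrX -natrM ler_nat.
Qed.

Let H_compare t e : 0 < e -> limsup_le_liminf (H t) (H (t - e)).
Proof.
move=> e0 eta eta0; pose del := Num.min 1 (eta / (d%:R * C%:R + 1)).
have dC1 : 0 < d%:R * C%:R + 1 :> R by rewrite ltr_pwDr // mulr_ge0.
have del0 : 0 < del by rewrite lt_min ltr01 divr_gt0.
have del_eta : del * (d%:R * C%:R + 1) <= eta.
  by rewrite -ler_pdivlMr // ge_min lexx orbT.
have del01 : 0 < del <= 1 by rewrite del0 ge_min lexx.
apply: filterS2 (nbhs_infty_ge 1) (H_compare_mul t e0 del01) => p p1.
apply: filterS => n.
have : d%:R * del * H t p <= d%:R * del * C%:R.
  apply: ler_wpM2l; first by rewrite mulr_ge0 // ltW.
  exact: le_trans (H_le_U t p1) (U_le_C p).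
lra.
Qed.

Let cvg_U : cvgn U.
Proof.
apply: (limsup_le_liminf_cvgn (M := C%:R)).
  by move=> n; rewrite ger0_norm ?U_le_C // divr_ge0 // ltW.
move=> eta eta0; apply: filterS2 H_lowE (H_compare (- c) ltr01 eta0) => p ->.
apply: filterS2 (nbhs_infty_ge 1) => n n1 /le_trans; apply.
by rewrite lerD2r H_le_U.
Qed.

Let lim_U_gt0 : 0 < limn U.
Proof.
have d2 : 0 < d%:R + 2 :> R by rewrite ltr_wpDl.
pose del : R := 1 / (d%:R + 2); have del01 : 0 < del <= 1.
  by rewrite divr_gt0 //= ler_pdivrMr // mul1r; have := ler0n R d; lra.
have [p [Up hp]] : exists p, H (- c) p = U p /\
    \forall n \near \oo, (1 - d%:R * del) * H (- c) p <= H (- c - 1) n.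
  near \oo%classic => p; exists p; split; first by near: p; exact: H_lowE.
  by near: p; exact: H_compare_mul.
apply: (@lt_le_trans _ _ ((1 - d%:R * del) * U p)).
  apply: mulr_gt0; last by rewrite divr_gt0 // ltr0n vdim_graded_gt0.
  by rewrite subr_gt0 mulrA mulr1 ltr_pdivrMr // mul1r; lra.
apply: limr_ge cvg_U _; rewrite -Up.
apply: filterS2 (nbhs_infty_ge 1) hp => n n1 /le_trans; apply.
exact: H_le_U.
Unshelve. all: by end_near. Qed.

Theorem tail_ratio_compare t e : 0 < e ->
  limsup_le_liminf (tail_ratio t) (tail_ratio (t - e)).
Proof.
move=> e0; have ratioE s : tail_ratio s = (fun n => H s n / U n).
  by apply/funext => n; rewrite /H /U invf_div mulrA divfK // gt_eqF.
rewrite !ratioE.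
apply: limsup_le_liminf_div (H_compare t e0) cvg_U lim_U_gt0 _.
by apply: filterS (nbhs_infty_ge 1) => n n1; rewrite H_ge0 H_le_U.
Qed.

End DimensionRatios.

(** * Convergence of the measures *)

Section UnitMass.
Context (R : realType) (mu : {measure set R -> \bar R}).
Hypothesis mu1 : mu setT = 1%E.

Lemma unit_mass_fin D : measurable D -> mu D \is a fin_num.
Proof.
move=> mD; rewrite ge0_fin_numE //; apply: le_lt_trans (ltry 1).
by rewrite -mu1; apply: le_measure; rewrite ?inE.
Qed.

Lemma fine_mass_le D E : measurable D -> measurable E -> D `<=` E ->
  fine (mu D) <= fine (mu E).
Proof.
move=> mD mE DE; rewrite fine_le ?unit_mass_fin //.
by apply: le_measure; rewrite ?inE.
Qed.

Lemma fine_mass_le1 D : measurable D -> fine (mu D) <= 1.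
Proof.
move=> mD; have -> : 1 = fine (mu setT) by rewrite mu1.
exact: fine_mass_le.
Qed.

Lemma fine_massC D : measurable D -> fine (mu (~` D)) = 1 - fine (mu D).
Proof.
move=> mD; have mDC : measurable (~` D) by exact: measurableC.
have := congr1 fine mu1; rewrite -(setUv D) measureU ?setICr // fineD ?unit_mass_fin //=.
by move=> <-; rewrite addrAC subrr add0r.
Qed.

Lemma fine_mass_itvoc (y z : R) : y <= z ->
  fine (mu `]y, z]) = fine (mu `]-oo, z]) - fine (mu `]-oo, y]).
Proof.
move=> yz; have -> : `]-oo, z] = `]-oo, y] `|` `]y, z] :> set R.
  by rewrite -itv_bndbnd_setU //= bnd_simp.
rewrite measureU // ?fineD ?unit_mass_fin //; first by rewrite addrAC subrr add0r.
by apply/seteqP; split=> // x /=; rewrite !in_itv /= => -[xy /andP[yx _]]; lra.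
Qed.

Context (phi : R -> R) (M : R).
Hypotheses (mphi : measurable_fun setT phi) (phiM : forall x, `|phi x| <= M).

Lemma unit_mass_integrable D : measurable D -> mu.-integrable D (EFin \o phi).
Proof.
move=> mD; apply: measurable_bounded_integrable => //.
- by rewrite -ge0_fin_numE // unit_mass_fin.
- exact: measurable_funTS.
- by exists M; split; [exact: num_real|move=> x Mx y _; exact: le_trans (ltW Mx)].
Qed.

Lemma cst_integrable D (v : R) : measurable D -> mu.-integrable D (EFin \o cst v).
Proof.
move=> mD; apply: measurable_bounded_integrable => //.
- by rewrite -ge0_fin_numE // unit_mass_fin.
- exact: bounded_cst.
Qed.

Lemma Rintegral_near_cst D (v e : R) : measurable D ->
  (forall x, D x -> `|phi x - v| <= e) ->
  `|\int[mu]_(x in D) phi x - v * fine (mu D)| <= e * fine (mu D).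
Proof.
move=> mD he; rewrite -!Rintegral_cst //.
rewrite -RintegralB //; [|exact: unit_mass_integrable|exact: cst_integrable].
have iD : mu.-integrable D (EFin \o (fun x => phi x - v)).
  have -> : EFin \o (fun x => phi x - v) = ((EFin \o phi) \- (EFin \o cst v))%E.
    by apply/funext => x; rewrite /= EFinB.
  by apply: integrableB => //; [exact: unit_mass_integrable|exact: cst_integrable].
apply: le_trans (le_normr_Rintegral mD iD) _.
apply: le_Rintegral => //; last exact: cst_integrable.
by have := integrable_abse iD.
Qed.

Lemma Rintegral_itvoc_split (x y z : R) : x <= y -> y <= z ->
  \int[mu]_(t in `]x, z]) phi t =
  \int[mu]_(t in `]x, y]) phi t + \int[mu]_(t in `]y, z]) phi t.
Proof.
move=> xy yz; have -> : `]x, z] = `]x, y] `|` `]y, z] :> set R.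
  by rewrite -itv_bndbnd_setU //= bnd_simp.
rewrite Rintegral_setU //.
  by apply: unit_mass_integrable; exact: measurableU.
apply/disj_setPS => t /=; rewrite !in_itv /= => -[/andP[_ ty] /andP[yt _]]; lra.
Qed.

Lemma integral_support D : measurable D -> (forall x, ~ D x -> phi x = 0) ->
  (\int[mu]_x (phi x)%:E = (\int[mu]_(x in D) phi x)%:E)%E.
Proof.
move=> mD phi0; rewrite /Rintegral fineK ?integrable_fin_num ?unit_mass_integrable //.
rewrite [RHS]integral_mkcond; apply: eq_integral => x _; rewrite patchE.
by case: ifPn => // /negP xD; rewrite phi0 // => Dx; apply: xD; rewrite inE.
Qed.

End UnitMass.

Lemma exists_ge_of_progress (R : realType) (S : set R) (b : R) : S !=set0 ->
  (forall s, exists2 d, 0 < d &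
    forall y, S y -> s - d < y <= s -> exists2 z, S z & s < z) ->
  exists2 y, S y & b <= y.
Proof.
move=> [x0 Sx0] prog; apply: contrapT => no.
have ubS : ubound S b.
  by move=> y Sy; rewrite leNgt; apply/negP => /ltW bly; apply: no; exists y.
have supS : has_sup S by split; [exists x0|exists b].
have [d d0 hd] := prog (sup S); have [y Sy hy] := sup_adherent d0 supS.
have [|z Sz] := hd y Sy; first by rewrite hy; exact: sup_upper_bound.
by rewrite ltNge => /negP; apply; exact: sup_upper_bound.
Qed.

Section CompactSupport.
Context (R : realType) (phi : R -> R).
Hypothesis supp_phi : compact (closure [set x | phi x != 0]).

Lemma compact_support_vanish : exists T, forall x, T < `|x| -> phi x = 0.
Proof.
have [T [_ hT]] := compact_bounded supp_phi; exists (T + 1) => x Tx.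
apply/eqP; apply: contraTT Tx => px; rewrite -leNgt.
by apply: hT; [rewrite ltrDl|exact: subset_closure].
Qed.

Lemma compact_support_bounded : continuous phi -> exists M, forall x, `|phi x| <= M.
Proof.
move=> cphi; have : compact (phi @` closure [set x | phi x != 0]).
  by apply: continuous_compact => //; exact: continuous_subspaceT.
move=> /compact_bounded[M [_ hM]]; exists (Num.max 0 (M + 1)) => x; rewrite le_max.
have [->|px] := eqVneq (phi x) 0; first by rewrite normr0 lexx.
apply/orP; right; apply: (hM (M + 1)); first by rewrite ltrDl.
by exists x => //; exact: subset_closure.
Qed.

End CompactSupport.

Section VagueCriterion.
Context (R : realType) (nus : nat -> {measure set R -> \bar R}).
Context (nu : {measure set R -> \bar R}).
Hypotheses (nus1 : forall n, nus n setT = 1%E) (nu1 : nu setT = 1%E).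

Definition cvg_cdf_at (x : R) : Prop :=
  (fun n => fine (nus n `]-oo, x])) @ \oo --> fine (nu `]-oo, x]).

Lemma cvg_itvoc y z : y <= z -> cvg_cdf_at y -> cvg_cdf_at z ->
  (fun n => fine (nus n `]y, z])) @ \oo --> fine (nu `]y, z]).
Proof.
move=> yz hy hz; rewrite (fine_mass_itvoc nu1 yz).
under eq_fun do rewrite (fine_mass_itvoc (nus1 _) yz).
exact: cvgB hz hy.
Qed.

Section TestFunction.
Context (phi : R -> R) (M e : R).
Hypotheses (cphi : continuous phi) (phiM : forall x, `|phi x| <= M).

Let mphi : measurable_fun setT phi.
Proof. exact: continuous_measurable_fun. Qed.

(* [J] is the integral of a step function that is uniformly [e]-close to [phi]
   on [`]x, y]] and whose nodes are points of convergence. *)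
Definition step_approx (x y : R) : Prop :=
  exists J : {measure set R -> \bar R} -> R,
    (forall mu : {measure set R -> \bar R}, mu setT = 1%E ->
      `|\int[mu]_(t in `]x, y]) phi t - J mu| <= e * fine (mu `]x, y])) /\
    (fun n => J (nus n)) @ \oo --> J nu.

Lemma step_approx_refl x : step_approx x x.
Proof.
exists (fun=> 0); split; last exact: cvg_cst.
by move=> mu _; rewrite set_itvoc0 Rintegral_set0 measure0 subrr normr0 mulr0.
Qed.

Lemma step_approx_extend x y z v : x <= y -> y <= z -> cvg_cdf_at y -> cvg_cdf_at z ->
  (forall t, y < t -> t <= z -> `|phi t - v| <= e) -> step_approx x y -> step_approx x z.
Proof.
move=> xy yz cy cz osc [J [hJ cJ]]; exists (fun mu => J mu + v * fine (mu `]y, z])).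
split=> [mu mu1|]; last by apply: cvgD cJ _; apply: cvgMr; exact: cvg_itvoc.
have osc_yz t : `]y, z]%classic t -> `|phi t - v| <= e.
  by rewrite /= in_itv /= => /andP[]; exact: osc.
have close_xy := hJ mu mu1.
have close_yz := Rintegral_near_cst mu1 mphi phiM (measurable_itv _) osc_yz.
have mass_xz : fine (mu `]x, z]) = fine (mu `]x, y]) + fine (mu `]y, z]).
  rewrite !fine_mass_itvoc //; last exact: le_trans yz.
  by ring.
rewrite (Rintegral_itvoc_split mu1 mphi phiM xy yz) mass_xz mulrDr opprD addrACA.
exact: le_trans (ler_normD _ _) (lerD close_xy close_yz).
Qed.

Hypotheses (e0 : 0 < e).
Hypothesis dense_cvg_cdf :
  forall u v, u < v -> exists x, [/\ u < x, x < v & cvg_cdf_at x].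

Lemma exists_step_approx x b : cvg_cdf_at x ->
  exists y, [/\ x <= y, b <= y & step_approx x y].
Proof.
move=> cx; pose S := [set y | [/\ x <= y, cvg_cdf_at y & step_approx x y]].
have [||y [xy _ Jy] bly] := @exists_ge_of_progress R S b; last by exists y.
  by exists x; split=> //; exact: step_approx_refl.
move=> s; have /cvgrPdist_le/(_ _ e0)[d /= d0 hd] := @cphi s.
exists d => // y [xy cy Jy] /andP[dy ys].
have [z [sz zd cz]] := @dense_cvg_cdf s (s + d) (ltac:(lra)).
exists z => //; split=> //; first lra.
apply: (@step_approx_extend x y z (phi s)) => // [|t yt tz]; first lra.
by rewrite distrC; apply: hd; rewrite /ball_ /= ltr_norml; lra.
Qed.

End TestFunction.

Hypothesis dense_cvg_cdf :
  forall u v, u < v -> exists x, [/\ u < x, x < v & cvg_cdf_at x].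

Theorem vague_cvg_of_cdf : vague_cvg nus nu.
Proof.
move=> phi cphi supp_phi.
have [M phiM] := compact_support_bounded supp_phi cphi.
have mphi : measurable_fun setT phi by exact: continuous_measurable_fun.
have [T phi0] := compact_support_vanish supp_phi.
have [x [_ xT cx]] := @dense_cvg_cdf (- T - 1) (- T) (ltac:(lra)).
have fin (mu : {measure set R -> \bar R}) : mu setT = 1%E ->
    (\int[mu]_x (phi x)%:E)%E \is a fin_num.
  move=> mu1; apply: integrable_fin_num; first exact: measurableT.
  exact: (unit_mass_integrable mu1 mphi phiM).
rewrite -(fineK (fin nu nu1)); apply/fine_cvgP; split.
  by near=> n; exact: fin.
apply/cvgrPdist_le => eps eps0; have e0 : 0 < eps / 3 by rewrite divr_gt0.
have [y [xy Ty [J [hJ]]]] := exists_step_approx cphi phiM e0 dense_cvg_cdf T cx.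
move=> /cvgrPdist_le/(_ _ e0); apply: filterS => n hn.
have phi_xy t : ~ `]x, y]%classic t -> phi t = 0.
  move=> h; apply: phi0; rewrite ltNge; apply/negP; rewrite ler_norml => /andP[t1 t2].
  by apply: h; rewrite /= in_itv /=; lra.
have mI : measurable (`]x, y]%classic : set R) by exact: measurable_itv.
have close (mu : {measure set R -> \bar R}) : mu setT = 1%E ->
    `|fine (\int[mu]_t (phi t)%:E)%E - J mu| <= eps / 3.
  move=> mu1; rewrite (integral_support mu1 mphi phiM mI phi_xy) /=.
  apply: le_trans (hJ mu mu1) _.
  by rewrite -[leRHS]mulr1 ler_wpM2l ?fine_mass_le1 // ltW.
move: (close _ nu1) (close _ (nus1 n)) hn; rewrite /= !ler_distl.
by move=> /andP[? ?] /andP[? ?] /andP[? ?]; apply/andP; split; lra.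
Unshelve. all: by end_near. Qed.

End VagueCriterion.

Lemma cumulative_continuity_point (R : realType) (Fc : cumulative R R) (u v : R) :
  u < v -> exists x, [/\ u < x, x < v & Fc y @[y --> x^'-] --> Fc x].
Proof.
move=> uv; apply: contrapT => no.
have sub : `]u, v[ `<=` [set x | x \in `]u, v[%R /\ discontinuity Fc x].
  move=> x xuv; split=> //; have := xuv; rewrite /= in_itv /= => /andP[ux xv].
  have cvg_right : Fc y @[y --> x^'+] --> Fc x by exact: cumulative_is_right_continuous.
  have cvg_left : cvg (Fc y @[y --> x^'-]).
    apply: nondecreasing_at_left_is_cvgr.
      by near=> z => s t _ _; exact: cumulative_is_nondecreasing.
    near=> z; exists (Fc x) => _ [t /= + <-]; rewrite in_itv /= => /andP[_ /ltW tx].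
    exact: cumulative_is_nondecreasing.
  split=> //; first by apply/cvg_ex; exists (Fc x).
  rewrite (cvg_lim _ cvg_right) //; apply/eqP => E; apply: no; exists x; split=> //.
  by rewrite -E.
have /countable_lebesgue_measure0 : countable (`]u, v[%classic : set R).
  apply: sub_countable (subset_card_le sub) _; apply: discontinuity_countable.
  by move=> s t _ _; exact: cumulative_is_nondecreasing.
rewrite lebesgue_measure_itv /= lte_fin uv -EFinD => /eqP; rewrite eqe subr_eq0.
by move=> /eqP vu; move: uv; rewrite vu ltxx.
Unshelve. all: by end_near. Qed.

Section StieltjesProbability.
Context (R : realType) (Fc : cumulativeBounded (0 : R) (1 : R)).

Let idTR : measurableTypeR R -> R := idfun.

#[local] HB.instance Definition _ :=
  @isMeasurableFun.Build _ _ _ _ idTR (@measurable_id _ _ setT).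

Lemma stieltjes_probability :
  exists nu : probability R R, forall x, nu `]-oo, x] = (Fc x)%:E.
Proof.
exists (distribution (lebesgue_stieltjes_measure Fc) idTR) => x.
exact: cdf_lebesgue_stieltjes_id.
Qed.

End StieltjesProbability.

Section LimitLaw.
Context (R : realType) (nus : nat -> {measure set R -> \bar R}) (a b : R).
Hypothesis nus1 : forall n, nus n setT = 1%E.

Let G t n : R := fine (nus n `[t, +oo[).

Hypotheses (Ga : \forall n \near \oo, G a n = 1) (Gb : \forall n \near \oo, G b n = 0).
Hypothesis G_compare : forall t e, 0 < e -> limsup_le_liminf (G t) (G (t - e)).

Let G_ge0 t n : 0 <= G t n.
Proof. exact: fine_ge0. Qed.

Let G_le1 t n : G t n <= 1.
Proof. exact: fine_mass_le1. Qed.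

Let G_mono n s t : s <= t -> G t n <= G s n.
Proof.
move=> st; apply: fine_mass_le => // x /=; rewrite !in_itv /= !andbT.
exact: le_trans.
Qed.

Let liminf_right (x : R) : set R :=
  [set l | exists2 y, x < y & \forall n \near \oo, l <= G y n].

(* The tail of the limit: the supremum over [y > x] of [liminf_n G y n]. *)
Let tail x : R := sup (liminf_right x).

Let liminf_right_le1 x l : liminf_right x l -> l <= 1.
Proof. by case=> y _ [N _ hN]; exact: le_trans (hN N (leqnn N)) (G_le1 y N). Qed.

Let has_sup_liminf_right x : has_sup (liminf_right x).
Proof.
split; last by exists 1 => l; exact: liminf_right_le1.
by exists 0, (x + 1); [rewrite ltrDl|exact/nearW/G_ge0].
Qed.

Let tail_ge x y l : x < y -> (\forall n \near \oo, l <= G y n) -> l <= tail x.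
Proof. by move=> xy hl; apply: (sup_upper_bound (has_sup_liminf_right x)); exists y. Qed.

Let tail_adherent x e : 0 < e ->
  exists2 y, x < y & \forall n \near \oo, tail x - e <= G y n.
Proof.
move=> e0; have [l [y xy hl] le_l] := sup_adherent e0 (has_sup_liminf_right x).
by exists y => //; apply: filterS hl => n; apply: le_trans; exact: ltW.
Qed.

Let tail_antitone x y : x <= y -> tail y <= tail x.
Proof.
move=> xy; apply: ge_sup (has_sup_liminf_right y).1 _ => l [z yz hl].
exact: tail_ge (le_lt_trans xy yz) hl.
Qed.

Let tail_eq1 x : x < a -> tail x = 1.
Proof.
move=> xa; apply/eqP; rewrite eq_le; apply/andP; split; last first.
  by apply: tail_ge xa _; apply: filterS Ga => n ->.
by apply: ge_sup (has_sup_liminf_right x).1 _; exact: liminf_right_le1.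
Qed.

Let tail_eq0 x : b <= x -> tail x = 0.
Proof.
move=> bx; apply/eqP; rewrite eq_le; apply/andP; split; last first.
  by apply: (@tail_ge x (x + 1)); [rewrite ltrDl|exact/nearW/G_ge0].
apply: ge_sup (has_sup_liminf_right x).1 _ => l [y xy hl].
have [N _ hN] : \forall n \near \oo, l <= 0; last exact: hN (leqnn N).
apply: filterS2 Gb hl => n Gbn /le_trans; apply; rewrite -Gbn G_mono //.
exact: le_trans bx (ltW xy).
Qed.

Let cdf_lim x : R := 1 - tail x.

Let cdf_lim_nondecreasing : nondecreasing cdf_lim.
Proof. by move=> x y xy; rewrite lerD2l lerN2 tail_antitone. Qed.

Let cdf_lim_right_continuous : right_continuous cdf_lim.
Proof.
move=> x; apply/cvgrPdist_le => e e0; have [y xy hy] := tail_adherent x e0.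
near=> z; have xz : x < z by near: z; exact: nbhs_right_gt.
have zy : z < y by near: z; exact: nbhs_right_lt.
rewrite distrC ger0_norm ?subr_ge0; last exact/cdf_lim_nondecreasing/ltW.
by rewrite /cdf_lim; have := tail_ge zy hy; lra.
Unshelve. all: by end_near. Qed.

HB.instance Definition _ :=
  isCumulative.Build R _ R cdf_lim cdf_lim_nondecreasing cdf_lim_right_continuous.

Let cdf_lim_Ny : cdf_lim @ -oo --> (0 : R).
Proof.
apply/cvgrPdist_le => e e0; near=> x.
rewrite /cdf_lim tail_eq1 ?subrr ?normr0 ?ltW //.
by near: x; apply: nbhs_ninfty_lt; exact: num_real.
Unshelve. all: by end_near. Qed.

Let cdf_lim_y : cdf_lim @ +oo --> (1 : R).
Proof.
apply/cvgrPdist_le => e e0; near=> x.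
rewrite /cdf_lim tail_eq0 ?subr0 ?subrr ?normr0 ?ltW //.
by near: x; apply: nbhs_pinfty_gt; exact: num_real.
Unshelve. all: by end_near. Qed.

HB.instance Definition _ := isCumulativeBounded.Build R 0 1 cdf_lim cdf_lim_Ny cdf_lim_y.

Let nus_cdfE n x : fine (nus n `]-oo, x]) = 1 - fine (nus n `]x, +oo[).
Proof. by rewrite -(fine_massC (nus1 n)) // setCitvr. Qed.

Let cvg_cdf_lim x : cdf_lim y @[y --> x^'-] --> cdf_lim x ->
  (fun n => fine (nus n `]-oo, x])) @ \oo --> cdf_lim x.
Proof.
move=> /cvgrPdist_le left_x; apply/cvgrPdist_le => e e0.
have e2 : 0 < e / 2 by rewrite divr_gt0.
have [y xy hy] := tail_adherent x e0.
have [z zx hz] : exists2 z, z < x & tail z <= tail x + e / 2.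
  near x^'- => z; exists z; first by near: z; exact: nbhs_left_lt.
  have : `|cdf_lim x - cdf_lim z| <= e / 2 by near: z; exact: left_x.
  by rewrite /cdf_lim ler_norml => /andP[_]; lra.
have hx : \forall n \near \oo, G x n <= tail z + e / 2.
  have xz0 : 0 < (x - z) / 2 by rewrite divr_gt0 // subr_gt0.
  apply: filterS (G_compare x xz0 e2) => p hp; rewrite -lerBlDr.
  apply: (@tail_ge z (x - (x - z) / 2)); first lra.
  by apply: filterS hp => n; rewrite lerBlDr.
apply: filterS2 hy hx => n hyn hxn; rewrite nus_cdfE /cdf_lim.
have le_G : fine (nus n `]x, +oo[) <= G x n.
  by apply: fine_mass_le => // t /=; rewrite !in_itv /= !andbT => /ltW.
have G_le : G y n <= fine (nus n `]x, +oo[).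
  by apply: fine_mass_le => // t /=; rewrite !in_itv /= !andbT; exact: lt_le_trans.
by rewrite ler_distl; apply/andP; split; lra.
Unshelve. all: by end_near. Qed.

Theorem exists_limit_law : exists nu : probability R R, vague_cvg nus nu.
Proof.
have [nu nuE] := stieltjes_probability cdf_lim; exists nu.
apply: vague_cvg_of_cdf nus1 (probability_setT nu) _ => u v uv.
have [x [ux xv left_x]] := cumulative_continuity_point cdf_lim uv.
exists x; split=> //; have := cvg_cdf_lim left_x.
by rewrite -[cdf_lim x]/(fine (cdf_lim x)%:E) -nuE.
Qed.

End LimitLaw.

(** * Rescaled filtration measures *)

Lemma limn_esup_lty_bound (R : realType) (u : nat -> \bar R) :
  (limn_esup u < +oo)%E -> exists M : R, \forall n \near \oo, (u n <= M%:E)%E.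
Proof.
move=> /ereal_inf_lt[_ [V Vn <-] supV]; exists (fine (maxe 0%E (ereal_sup (u @` V)))).
apply: filterS Vn => n Vn; rewrite fineK; last first.
  by rewrite ge0_fin_numE ?le_max ?lexx // gt_max ltry supV.
by rewrite le_max; apply/orP; right; apply: ereal_sup_ubound; exists n.
Qed.

Lemma filtration_upper (R : realType) (K : fieldType) (A : lmodType K)
    (B : nat -> A -> Prop) (F : nat -> R -> A -> Prop) :
  (forall n, (1 <= n)%N -> good_filtration (B n) (F n)) ->
  (limn_esup (fun n : nat =>
     ereal_sup [set (flambda (F n) a * ((n%:R)^-1)%R%:E)%E
               | a in [set a | B n a /\ a <> 0%R]]) < +oo)%E ->
  exists M : R, \forall n \near \oo, forall a, F n (n%:R * M) a -> a = 0.
Proof.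
move=> filtF /limn_esup_lty_bound[M hM]; exists (M + 1).
apply: filterS2 (nbhs_infty_ge 1) hM => n n1 supM a Fa; apply: contrapT => a0.
have n0 : 0 < n%:R :> R by rewrite ltr0n.
suff : ((M + 1)%:E <= M%:E)%E by rewrite lee_fin; lra.
apply: le_trans supM; apply: le_trans (ereal_sup_ubound _); last first.
  by exists a => //; split=> //; exact: (filtration_sub (filtF n n1)) Fa.
have -> : (M + 1)%:E = ((n%:R * (M + 1))%:E * n%:R^-1%:E)%E :> \bar R.
  by rewrite -EFinM mulrAC divff ?mul1r // gt_eqF.
apply: lee_wpmul2r; first by rewrite lee_fin invr_ge0 ltW.
by apply: ereal_sup_ubound; exists (n%:R * (M + 1)).
Qed.

Lemma Tscale_setT (R : realType) (mu : probability R R) (e : R) :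
  Tscale e mu setT = 1%E.
Proof. by rewrite /Tscale /pushforward preimage_setT; exact: probability_setT. Qed.

Lemma Tscale_tail (R : realType) (mu : {measure set R -> \bar R}) n (t : R) :
  (1 <= n)%N -> Tscale (n%:R)^-1 mu `[t, +oo[ = mu `[n%:R * t, +oo[.
Proof.
move=> n1; rewrite /Tscale /pushforward; congr (mu _); apply/seteqP; split=> x /=;
  by rewrite !in_itv /= !andbT ler_pdivlMr ?ltr0n // mulrC.
Qed.

Lemma msupport_null (R : realType) (nu : {measure set R -> \bar R}) (U : set R) :
  open U -> nu U = 0%E -> msupport nu `<=` ~` U.
Proof. by move=> oU nuU x /(_ U oU) supp_x /supp_x; rewrite nuU ltxx. Qed.

Lemma msupport_sub_itv (R : realType) (nu : {measure set R -> \bar R}) (a b : R) :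
  nu setT = 1%E -> nu `[a, +oo[ = 1%E -> nu `[b, +oo[ = 0%E ->
  msupport nu `<=` `[a, b].
Proof.
move=> nu1 nua nub x supp_x.
have nu_lt : nu `]-oo, a[ = 0%E.
  rewrite -(fineK (unit_mass_fin nu1 _)) // -setCitvr fine_massC //.
  by rewrite nua subrr.
have nu_gt : nu `]b, +oo[ = 0%E.
  apply/eqP; rewrite -measure_le0 -nub; apply: le_measure; rewrite ?inE // => y /=.
  by rewrite !in_itv /= !andbT => /ltW.
have : ~ `]-oo, a[%classic x by exact: msupport_null nu_lt _ supp_x.
have : ~ `]b, +oo[%classic x by exact: msupport_null nu_gt _ supp_x.
by rewrite /= !in_itv /= andbT => /negP + /negP; rewrite -!leNgt => -> ->.
Qed.

Section TailRatio.
Context (R : realType) (K : fieldType) (A : comAlgType K).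
Context (B : nat -> A -> Prop) (F : nat -> R -> A -> Prop) (d C : nat).
Hypothesis filtF : forall n, (1 <= n)%N -> good_filtration (B n) (F n).
Hypothesis dimB : dim_growth B d C.
Context (mu : nat -> probability R R).
Hypothesis muF : forall n, (1 <= n)%N -> is_filtration_measure (B n) (F n) (mu n).

Lemma Tscale_tail_ratio n t : (1 <= n)%N ->
  Tscale (n%:R)^-1 (mu n) `[t, +oo[ = (tail_ratio B F t n)%:E.
Proof.
move=> n1; rewrite Tscale_tail //; apply: (muF n1).
  exact/has_dim_vdim/(fin_dim_graded dimB).
exact/has_dim_vdim/(filtration_fin_dim (filtF n1))/(fin_dim_graded dimB).
Qed.

Lemma exists_tail_mass1 (c : R) : (forall n, exists2 a, B n a & a != 0) ->
  (\forall n \near \oo, forall a, B n a -> F n (- c * n%:R) a) ->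
  exists a, forall n, (1 <= n)%N -> Tscale (n%:R)^-1 (mu n) `[a, +oo[ = 1%E.
Proof.
move=> B_neq0 lowF.
have [a ha] : exists a, forall n, (1 <= n)%N -> forall x, B n x -> F n (n%:R * a) x.
  apply: (@exists_uniform_lower_near R _ (- c)); last first.
  - by apply: filterS lowF => n Bn _ x /Bn; rewrite mulrC.
  - move=> n; have [n1|] := leqP 1 n; last by exists 0.
    have [s hs] := filtration_full (filtF n1) (fin_dim_graded dimB n).
    by exists (s / n%:R) => _ x /hs; rewrite mulrC divfK // pnatr_eq0 -lt0n.
  - move=> n s t st ht n1 x /(ht n1); apply: (filtration_le (filtF n1)).
    by rewrite ler_wpM2l.
exists a => n n1; rewrite Tscale_tail_ratio // /tail_ratio.
rewrite (@eq_vdim _ _ (F n (n%:R * a)) (B n)).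
- by rewrite divff // pnatr_eq0 -lt0n (vdim_graded_gt0 dimB).
- by move=> x; split; [exact: (filtration_sub (filtF n1))|exact: ha].
- exact: fin_dim_graded dimB n.
Qed.

Lemma exists_tail_mass0 (M : R) :
  (\forall n \near \oo, forall a, F n (n%:R * M) a -> a = 0) ->
  exists b, forall n, (1 <= n)%N -> Tscale (n%:R)^-1 (mu n) `[b, +oo[ = 0%E.
Proof.
move=> upF.
have [b hb] : exists b, forall n, (1 <= n)%N -> forall x, F n (n%:R * - b) x -> x = 0.
  apply: (@exists_uniform_lower_near R _ (- M)); last first.
  - by apply: filterS upF => n Fn _ x; rewrite opprK; exact: Fn.
  - move=> n; have [n1|] := leqP 1 n; last by exists 0.
    have [s hs] := filtration_trivial (filtF n1) (fin_dim_graded dimB n).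
    exists (- (s / n%:R)) => _ x.
    by rewrite opprK mulrC divfK ?pnatr_eq0 -?lt0n //; exact: hs.
  - move=> n s t st ht n1 x Fx; apply: (ht n1); apply: (filtration_le (filtF n1)) Fx.
    by rewrite ler_wpM2l // lerN2.
exists (- b) => n n1.
rewrite Tscale_tail_ratio // /tail_ratio vdim_eq0 ?mul0r //; last exact: hb.
exact/(filtration_fin_dim (filtF n1))/(fin_dim_graded dimB).
Qed.

End TailRatio.

Theorem mainTheorem20 (R : realType) (K : fieldType) (A : comAlgType K)
  (f : nat -> R)
  (B : nat -> A -> Prop) (F : nat -> R -> A -> Prop)
  (mu : nat -> probability R R) :
  (* f : Z_{>=0} -> R_{>=0} increasing, with sum_a f(2^a)/2^a < +oo *)
  (forall n, 0 <= f n) ->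
  (forall n m, (n <= m)%N -> f n <= f m) ->
  cvgn (series (fun a : nat => f (2 ^ a)%N / (2 ^ a)%:R)) ->
  (* B = ⊕ B_n integral graded K-algebra of finite type generated by B_1 *)
  graded_alg B -> integral_alg A -> finite_type_alg A -> generated_by (B 1%N) ->
  (* (i) Krull dimension > 0 *)
  krull_dim_pos A ->
  (* (ii) filtrations and f-pseudo-filtered structure *)
  (forall n, (1 <= n)%N -> good_filtration (B n) (F n)) ->
  (exists N : nat, forall (n m : nat), (N <= n)%N -> (N <= m)%N ->
     forall (s t : R) (a b : A), F n s a -> F m t b ->
       F (n + m)%N (s + t - f n - f m) (a * b)) ->
  (* (iii) limsup_n sup_{0 <> a in B_n} lambda(a)/n < +oo *)
  (limn_esup (fun n : nat =>
     ereal_sup [set (flambda (F n) a * ((n%:R)^-1)%R%:E)%E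
               | a in [set a | B n a /\ a <> 0%R]]) < +oo)%E ->
  (* mu n = nu_{B_n} *)
  (forall n, (1 <= n)%N -> is_filtration_measure (B n) (F n) (mu n)) ->
  (* conclusion, with nu_n = T_{1/n} nu_{B_n} *)
  (exists a b : R, forall n, (1 <= n)%N ->
      msupport (Tscale (n%:R)^-1 (mu n)) `<=` `[a, b]) /\
  (exists nu : probability R R,
      vague_cvg (fun n => Tscale (n%:R)^-1 (mu n)) nu).
Proof.
move=> f0 f_mono f_cvg gB intA ftA genA krA filtF [N0 mulF] supF muF.
have mulB := graded_mul_generated gB ftA genA.
have B_neq0 := nonzero_graded gB intA ftA genA krA.
have [d [C [dimB powB]]] := graded_dim_growth gB intA ftA genA krA.
have [c [_ lowF]] := filtration_lower f0 f_mono f_cvg filtF mulF dimB mulB.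
have vdim_cmp := vdim_compare f0 f_mono f_cvg filtF mulF dimB mulB powB.
have tail_cmp := tail_ratio_compare filtF dimB B_neq0 lowF vdim_cmp.
have [M upF] := filtration_upper filtF supF.
have [a mass_a] := exists_tail_mass1 filtF dimB muF B_neq0 lowF.
have [b mass_b] := exists_tail_mass0 filtF dimB muF upF.
split.
  exists a, b => n n1.
  exact: (msupport_sub_itv (Tscale_setT _ _) (mass_a n n1) (mass_b n n1)).
apply: (@exists_limit_law R (fun n => Tscale (n%:R)^-1 (mu n)) a b).
- by move=> n; exact: Tscale_setT.
- by apply: filterS (nbhs_infty_ge 1) => n /mass_a /(congr1 fine).
- by apply: filterS (nbhs_infty_ge 1) => n /mass_b /(congr1 fine).
- move=> t e e0; apply: eq_limsup_le_liminf (tail_cmp t e e0);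
    apply: filterS (nbhs_infty_ge 1) => n n1;
    exact: (congr1 fine (esym (Tscale_tail_ratio filtF dimB muF _ n1))).
Qed.
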